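(* If $\boldsymbol\lambda$ and $\widehat{\boldsymbol\lambda}$ are two elements of $\mathfrak S^{\boldsymbol\sigma}_{\kappa,\mathbf f}(\mathbf A,\mathbf a,\mathbf g)$ (i.e. two solutions to the constrained $\mathbf f$-weighted minimum energy problem), then $\|\boldsymbol\lambda-\widehat{\boldsymbol\lambda}\|_{\mathcal E^+_\kappa(\mathbf A)}=0$, and hence $\boldsymbol\lambda$ and $\widehat{\boldsymbol\lambda}$ are $R$-equivalent in $\mathcal E^+_\kappa(\mathbf A)$, i.e. $R\boldsymbol\lambda=R\widehat{\boldsymbol\lambda}$. Thus a solution to this problem is unique (provided it exists) whenever all the $A_i$, $i\in I$, are mutually essentially disjoint, i.e. $c_\kappa(A_i\cap A_j)=0$ for all $i\ne j$.
   Context: $X$ is a locally compact Hausdorff space; $\mathfrak M(X)$ is the space of real-valued (signed) scalar Radon measures on $X$, $\mathfrak M^+(X)$ the cone of positive ones. $\Psi(X)$: lower semicontinuous functions $X\to(-\infty,\infty]$, nonnegative unless $X$ is compact. A kernel is a symmetric $\kappa\in\Psi(X\times X)$; $\kappa(\mu,\nu)=\iint\kappa\,d\mu\,d\nu$, $\kappa(x,\mu)=\int\kappa(x,y)\,d\mu(y)$ (when well defined). $\mathcal E_\kappa(X)$: all $\mu\in\mathfrak M(X)$ with $\kappa(\mu^+,\mu^+),\kappa(\mu^-,\mu^-),\kappa(\mu^+,\mu^-)$ finite. $\kappa$ is assumed strictly positive definite ($\kappa(\mu,\mu)\ge0$ whenever defined, and $=0$ only for $\mu=0$), so $\mathcal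 E_\kappa(X)$ is a pre-Hilbert space with norm $\|\mu\|_\kappa=\sqrt{\kappa(\mu,\mu)}$. Capacity: $c_\kappa(Q)=[\inf\kappa(\mu,\mu)]^{-1}$ over positive $\mu\in\mathcal E_\kappa(X)$ carried by $Q$ with $\mu(Q)=1$. $\mathbf A=(A_i)_{i\in I}$ is a generalized condenser: $I$ is finite, the $A_i\subset X$ are nonempty closed with prescribed signs $s_i=\pm1$, and $c_\kappa(A^+\cap A^-)=0$ with $A^\pm=\bigcup_{s_i=\pm1}A_i$; also $c_\kappa(A_i)>0$ for all $i$. $\mathfrak M^+(\mathbf A)$: all $\boldsymbol\mu=(\mu^i)_{i\in I}$ with $\mu^i\in\mathfrak M^+(X)$ supported by $A_i$; $\mathcal E^+_\kappa(\mathbf A)$: those with $\kappa(\mu^i,\mu^i)<\infty$ for all $i$. $R\boldsymbol\mu=\sum_{i\in I}s_i\mu^i$; $\kappa(\boldsymbol\mu,\boldsymbol\mu)=\sum_{i,j}s_is_j\kappa(\mu^i,\mu^j)=\kappa(R\boldsymbol\mu,R\boldsymbol\mu)$; semimetric $\|\boldsymbol\mu-\boldsymbol\nu\|_{\mathcal E^+_\kappa(\mathbf A)}=\|R\boldsymbol\mu-R\boldsymbol\nu\|_\kappa$. External field $\mathbf f=(f_i)_{i\in I}$: either Case I, $f_i\in\Psi(X)$ for all $i$, or Case II, $f_i(x)=s_i\kappa(x,\zeta)$ for all $i$ with a given (signed) $\zeta\in\mathcal E_\kappa(X)$. $G_{\kappa,\mathbf f}(\boldsymbol\mu)=\kappa(\boldsymbol\mu,\boldsymbol\mu)+2\sum_i\int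 f_i\,d\mu^i$. $\mathbf a=(a_i)_{i\in I}$ with $a_i>0$; $\mathbf g=(g_i)_{i\in I}$ with $g_i:X\to(0,\infty)$ continuous and $\inf_Xg_i>0$. A constraint $\boldsymbol\sigma=(\sigma^i)_{i\in I}\in\mathfrak C(\mathbf A)$ is an element of $\mathfrak M^+(\mathbf A)$ with $\int g_i\,d\sigma^i>a_i$ and support of $\sigma^i$ equal to $A_i$ for all $i$. $\mathcal E^{\boldsymbol\sigma}_{\kappa,\mathbf f}(\mathbf A,\mathbf a,\mathbf g)$: all $\boldsymbol\mu\in\mathcal E^+_\kappa(\mathbf A)$ with $G_{\kappa,\mathbf f}(\boldsymbol\mu)$ finite, $\mu^i\le\sigma^i$ and $\int g_i\,d\mu^i=a_i$ for all $i$. $G^{\boldsymbol\sigma}_{\kappa,\mathbf f}(\mathbf A,\mathbf a,\mathbf g)$ is the infimum of $G_{\kappa,\mathbf f}$ over this class, assumed $<\infty$ (i.e. the class is nonempty); it is always $>-\infty$. $\mathfrak S^{\boldsymbol\sigma}_{\kappa,\mathbf f}(\mathbf A,\mathbf a,\mathbf g)$ (possibly empty) is the set of all $\boldsymbol\lambda$ in this class with $G_{\kappa,\mathbf f}(\boldsymbol\lambda)=G^{\boldsymbol\sigma}_{\kappa,\mathbf f}(\mathbf A,\mathbf a,\mathbf g)$. *)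

(* Defs.v *)
From HB Require Import structures.
From mathcomp Require Import all_boot all_order all_algebra.
From mathcomp Require Import all_classical all_reals all_analysis.
From mathcomp Require Import lra.
Import numFieldNormedType.Exports.
Import Order.TTheory GRing.Theory Num.Theory.

Set Implicit Arguments.
Unset Strict Implicit.
Unset Printing Implicit Defensive.

Local Open Scope classical_set_scope.
Local Open Scope ring_scope.
Local Open Scope ereal_scope.

Notation borel X := (g_sigma_algebraType (@open X)).

(* In a Hausdorff space every compact set is closed; asking for closedness
   keeps the constructions below free of a separation hypothesis. *)
Definition ccompact (X : ptopologicalType) (K : set X) :=
  compact K /\ closed K.

Section radon.
Context (R : realType) (X : ptopologicalType).

(* Positive Radon measures, i.e. positive linear functionals on C_c(X), are
   identified with the Borel measures that are finite on compact sets and inner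
   regular with respect to compact sets (no sigma-finiteness is assumed). *)
Definition is_radon (mu : set (borel X) -> \bar R) :=
  (forall K : set X, ccompact K -> mu K < +oo) /\
  (forall B : set (borel X), measurable B ->
     mu B = ereal_sup [set mu K | K in [set K : set X | ccompact K /\ K `<=` B]]).

Record radon := Radon {
  radon_measure :> {measure set (borel X) -> \bar R};
  radonP : is_radon radon_measure }.

(* Values on non-Borel sets carry no information, so measures are compared on
   Borel sets only. *)
Definition radon_eq (mu nu : radon) :=
  forall B : set (borel X), measurable B -> mu B = nu B.

Definition radon_le (mu nu : radon) :=
  forall B : set (borel X), measurable B -> mu B <= nu B.

Lemma ccompact_measurable (K : set X) :
  ccompact K -> measurable (K : set (borel X)).
Proof.
move=> [_ cK]; rewrite -(setCK K); apply: measurableC.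
by apply: sub_sigma_algebra; exact: closed_openC.
Qed.

Lemma ccompactU (K L : set X) : ccompact K -> ccompact L -> ccompact (K `|` L).
Proof.
by move=> [cK kK] [cL kL]; split; [exact: compactU|exact: closedU].
Qed.

Lemma ccompact_set0 : ccompact (@set0 X).
Proof. by split; [exact: compact0|exact: closed0]. Qed.

Lemma ereal_supD_le (A B : set (\bar R)) (S : \bar R) : A !=set0 -> B !=set0 ->
  (forall a, A a -> a \is a fin_num) -> (forall b, B b -> b \is a fin_num) ->
  (forall a b, A a -> B b -> a + b <= S) -> ereal_sup A + ereal_sup B <= S.
Proof.
move=> [a0 Aa0] [b0 Bb0] fA fB H.
have H1 b : B b -> ereal_sup A + b <= S.
  move=> Bb; rewrite -leeBrDr ?fB//; apply: ge_ereal_sup => a Aa.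
  by rewrite leeBrDr ?fB//; exact: H.
have A0 : ereal_sup A != -oo.
  rewrite gt_eqF// (@lt_le_trans _ _ a0)//; last exact: ereal_sup_ubound.
  by rewrite ltNye_eq fA.
have [Afin|] := boolP (ereal_sup A \is a fin_num).
  rewrite addeC -leeBrDr//; apply: ge_ereal_sup => b Bb.
  by rewrite leeBrDr// addeC; exact: H1.
rewrite fin_numE negb_and !negbK (negbTE A0)/= => /eqP Ay.
have := H1 _ Bb0; rewrite Ay addye; last by have := fB _ Bb0; case: (b0).
by rewrite leye_eq => /eqP ->; rewrite leey.
Qed.

Section add.
Variables mu nu : radon.

Lemma radon_add_subproof : is_radon (measure_add mu nu).
Proof.
have [[muf muR] [nuf nuR]] := (radonP mu, radonP nu).
split=> [K cK|B mB].
  by rewrite measure_addE lte_add_pinfty ?muf ?nuf.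
apply/eqP; rewrite eq_le; apply/andP; split; last first.
  apply: ge_ereal_sup => _ [K [cK KB] <-].
  rewrite [in leLHS]measure_addE [in leRHS]measure_addE.
  by apply: leeD; apply: le_measure; rewrite ?inE//; exact: ccompact_measurable.
rewrite measure_addE (muR _ mB) (nuR _ mB); apply: ereal_supD_le.
- by exists (mu set0), set0 => //; split => //; exact: ccompact_set0.
- by exists (nu set0), set0 => //; split => //; exact: ccompact_set0.
- by move=> _ [K [cK _] <-]; rewrite ge0_fin_numE// muf.
- by move=> _ [K [cK _] <-]; rewrite ge0_fin_numE// nuf.
move=> _ _ [K [cK KB] <-] [L [cL LB] <-].
apply: (@le_trans _ _ (measure_add mu nu (K `|` L))); last first.
  apply: ereal_sup_ubound; exists (K `|` L) => //.
  by split; [exact: ccompactU|rewrite subUset].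
rewrite measure_addE; apply: leeD; apply: le_measure; rewrite ?inE//.
- exact: ccompact_measurable.
- by apply: ccompact_measurable; exact: ccompactU.
- exact: ccompact_measurable.
- by apply: ccompact_measurable; exact: ccompactU.
Qed.

Definition radon_add : radon := Radon radon_add_subproof.

Lemma radon_addE B : radon_add B = mu B + nu B.
Proof. exact: measure_addE. Qed.

End add.

Lemma radon0_subproof : is_radon (@mzero _ (borel X) R).
Proof.
split=> [K _|B _]; first by rewrite /mzero ltry.
apply/eqP; rewrite eq_le; apply/andP; split.
  apply: ereal_sup_ubound; exists set0 => //; split=> //; exact: ccompact_set0.
by apply: ge_ereal_sup => _ [K _ <-].
Qed.

Definition radon0 : radon := Radon radon0_subproof.

Section pos_part.
Variables mu nu : radon.

Definition bounded_borel (B E : set (borel X)) :=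
  [/\ measurable E, E `<=` B & exists2 K : set X, ccompact K & E `<=` K].

(* The positive part of the difference mu - nu. *)
Definition pos_part (B : set (borel X)) : \bar R :=
  ereal_sup [set mu E - nu E | E in bounded_borel B].

End pos_part.

Lemma bounded_fin (mu : radon) B E : bounded_borel B E -> mu E \is a fin_num.
Proof.
move=> [mE _ [K cK EK]]; rewrite ge0_fin_numE//.
apply: le_lt_trans ((radonP mu).1 _ cK).
by apply: le_measure; rewrite ?inE//; exact: ccompact_measurable.
Qed.

Lemma bounded_borel0 B : bounded_borel B set0.
Proof. by split => //; exists set0 => //; exact: ccompact_set0. Qed.

Lemma sub_bounded_borel B B' E E' : bounded_borel B E -> measurable E' ->
  E' `<=` E -> E' `<=` B' -> bounded_borel B' E'.
Proof.
move=> [mE _ [K cK EK]] mE' E'E E'B'; split=> //.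
by exists K => //; exact: subset_trans EK.
Qed.

Lemma bounded_borelU B B' E E' : bounded_borel B E -> bounded_borel B' E' ->
  bounded_borel (B `|` B') (E `|` E').
Proof.
move=> [mE EB [K cK EK]] [mE' EB' [K' cK' EK']]; split.
- exact: measurableU.
- exact: setUSS.
- by exists (K `|` K'); [exact: ccompactU|exact: setUSS].
Qed.

Lemma ccompact_bounded (K : set X) : ccompact K -> bounded_borel K K.
Proof. by move=> cK; split=> //; [exact: ccompact_measurable|exists K]. Qed.

Section pos_part_measure.
Variables mu nu : radon.
Local Notation delta := (pos_part mu nu).

Lemma pos_part_le B E : bounded_borel B E -> mu E <= delta B + nu E.
Proof.
move=> bE; rewrite -leeBlDr ?(bounded_fin _ bE)//.
by apply: ereal_sup_ubound; exists E.
Qed.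

Lemma pos_part_subset B B' : B `<=` B' -> delta B <= delta B'.
Proof.
move=> BB'; apply: le_ereal_sup => _ [E bE <-]; exists E => //.
have [mE EB _] := bE.
by apply: (sub_bounded_borel bE) => //; exact: subset_trans BB'.
Qed.

Lemma pos_part0 : delta set0 = 0.
Proof.
rewrite /pos_part (_ : [set _ | _ in _] = [set 0]) ?ereal_sup1//.
apply/seteqP; split=> [_ [E [_ + _] <-]|_ ->].
  by rewrite subset0 => ->; rewrite !measure0 sube0.
by exists set0; [exact: bounded_borel0|rewrite !measure0 sube0].
Qed.

Lemma pos_part_ge0 B : 0 <= delta B.
Proof. by rewrite -pos_part0; apply: pos_part_subset. Qed.

Lemma pos_part_superadd A B : [disjoint A & B] ->
  delta A + delta B <= delta (A `|` B).
Proof.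
move=> AB; apply: ereal_supD_le.
- by exists (mu set0 - nu set0), set0 => //; exact: bounded_borel0.
- by exists (mu set0 - nu set0), set0 => //; exact: bounded_borel0.
- by move=> _ [E bE <-]; rewrite fin_numB !(bounded_fin _ bE).
- by move=> _ [E bE <-]; rewrite fin_numB !(bounded_fin _ bE).
move=> _ _ [E bE <-] [F bF <-].
have [[mE EA _] [mF FB _]] := (bE, bF).
have EF : E `&` F = set0 by apply: subsetI_eq0 EA FB _; exact/eqP.
apply: ereal_sup_ubound; exists (E `|` F); first exact: bounded_borelU.
have mEF (m : radon) : m (E `|` F) = m E + m F by exact: measureU.
rewrite !mEF; move: (bounded_fin mu bE) (bounded_fin nu bE).
move: (bounded_fin mu bF) (bounded_fin nu bF).
case: (mu E) (nu E) (mu F) (nu F) => [a||] [b||] [c||] [d||] //= _ _ _ _.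
by rewrite -!EFinD opprD addrACA.
Qed.

Lemma pos_part_sigma_additive : semi_sigma_additive delta.
Proof.
move=> F mF tF mUF.
have -> : delta (\bigcup_n F n) = \sum_(n <oo) delta (F n).
  apply/eqP; rewrite eq_le; apply/andP; split; last first.
    apply: lime_le; first by apply: is_cvg_nneseries => *; exact: pos_part_ge0.
    apply: nearW => n; apply: (@le_trans _ _ (delta (\big[setU/set0]_(i < n) F i))).
      elim: n => [|n IHn]; first by rewrite big_geq// big_ord0 pos_part0.
      rewrite big_nat_recr//= big_ord_recr/=.
      apply: le_trans (leeD2r _ IHn) _; apply: pos_part_superadd.
      apply/eqP; rewrite -bigcup_mkord setI_bigcupl bigcup0// => i /= ltin.
      by move/trivIsetP : tF => ->//; rewrite neq_ltn ltin.
    by apply: pos_part_subset; rewrite -bigcup_mkord; apply: bigcup_sub => i _;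
       exact: bigcup_sup.
  apply: ge_ereal_sup => _ [E bE <-]; rewrite leeBlDr ?(bounded_fin _ bE)//.
  have [mE EF _] := bE.
  have tE : trivIset setT (fun n => E `&` F n) by exact: trivIset_setIl.
  have mEF n : measurable (E `&` F n) by exact: measurableI.
  have EE : E = \bigcup_n (E `&` F n) by rewrite -setI_bigcupr; apply/esym/setIidPl.
  have sE (m : radon) : m E = \sum_(n <oo) m (E `&` F n).
    by rewrite {1}EE measure_semi_bigcup// -EE.
  rewrite !sE -nneseriesD; last 2 first.
    by move=> *; exact: pos_part_ge0.
    by [].
  apply: lee_nneseries => [//|n _]; apply: pos_part_le.
  by apply: (sub_bounded_borel bE).
by apply: is_cvg_nneseries => *; exact: pos_part_ge0.
Qed.

HB.instance Definition _ := isMeasure.Build _ _ _ (pos_part mu nu)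
  pos_part0 pos_part_ge0 pos_part_sigma_additive.

Lemma pos_part_radon_subproof : is_radon (pos_part mu nu).
Proof.
split=> [K cK|B mB].
  apply: le_lt_trans ((radonP mu).1 _ cK); apply: ge_ereal_sup => _ [E bE <-].
  apply: (@le_trans _ _ (mu E)); first by rewrite leeBlDr ?(bounded_fin _ bE)// leeDl.
  by have [mE EK _] := bE; apply: le_measure; rewrite ?inE//;
     exact: ccompact_measurable.
apply/eqP; rewrite eq_le; apply/andP; split; last first.
  by apply: ge_ereal_sup => _ [K [cK KB] <-]; exact: pos_part_subset.
apply: ge_ereal_sup => _ [E bE <-]; rewrite leeBlDr ?(bounded_fin _ bE)//.
have [mE EB _] := bE.
rewrite ((radonP mu).2 _ mE); apply: ge_ereal_sup => _ [K [cK KE] <-].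
apply: le_trans (pos_part_le (ccompact_bounded cK)) _; apply: leeD.
  apply: ereal_sup_ubound; exists K => //; split=> //.
  exact: subset_trans EB.
by apply: le_measure; rewrite ?inE//; exact: ccompact_measurable.
Qed.

Definition radon_pos_part : radon := Radon pos_part_radon_subproof.

End pos_part_measure.

(* mu /\ nu = 0 in the lattice of Radon measures. *)
Definition radon_ortho (mu nu : radon) :=
  forall rho : radon, radon_le rho mu -> radon_le rho nu -> radon_eq rho radon0.

(* A signed Radon measure is given by its Hahn-Jordan decomposition in the
   vector lattice of Radon measures. Both parts may be infinite, so this is not
   a (finite) charge. *)
Record sradon := SRadon {
  spos : radon;
  sneg : radon;
  sradonP : radon_ortho spos sneg }.

Definition sradon_eq (m n : sradon) :=
  radon_eq (spos m) (spos n) /\ radon_eq (sneg m) (sneg n).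

Definition sradon_is0 (m : sradon) :=
  radon_eq (spos m) radon0 /\ radon_eq (sneg m) radon0.

Lemma radon_eq_ccompact (mu nu : radon) :
  (forall K, ccompact K -> mu K = nu K) -> radon_eq mu nu.
Proof.
move=> H B mB; rewrite (radonP mu).2// (radonP nu).2//; congr ereal_sup.
by apply: eq_imagel => K [/H].
Qed.

Lemma radon_pos_part_ortho (mu nu : radon) :
  radon_ortho (radon_pos_part mu nu) (radon_pos_part nu mu).
Proof.
move=> rho rhop rhon; apply: radon_eq_ccompact => K cK.
have mK := ccompact_measurable cK.
have rhoK : rho K \is a fin_num by exact: bounded_fin (ccompact_bounded cK).
pose D := radon_pos_part mu nu; pose D' := radon_pos_part nu mu.
have DK : D K \is a fin_num by exact: bounded_fin (ccompact_bounded cK).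
have D'K : D' K \is a fin_num by exact: bounded_fin (ccompact_bounded cK).
suff : D K <= (fine (D K) - fine (rho K) / 2)%:E.
  rewrite -[in leLHS](fineK DK) lee_fin => le0.
  have : rho K <= 0 by rewrite -(fineK rhoK) lee_fin; lra.
  by move=> rho0; apply/eqP; rewrite eq_le rho0 measure_ge0.
apply: ge_ereal_sup => _ [E bE <-]; have [mE EK _] := bE.
have splitB (r : radon) A B : measurable A -> measurable B -> B `<=` A ->
    r A = r B + r (A `\` B).
  move=> mA mB BA; rewrite -[in LHS](setDUK BA) measureU//; last exact: setDIK.
  exact: measurableD.
have mKE : measurable ((K : set (borel X)) `\` E) by exact: measurableD.
have bKE : bounded_borel K (K `\` E).
  by apply: (sub_bounded_borel (ccompact_bounded cK)) => //; exact: subDsetl.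
have muE := bounded_fin mu bE; have nuE := bounded_fin nu bE.
have DE := bounded_fin D bE; have DKE := bounded_fin D bKE.
have D'E := bounded_fin D' bE.
have h1 : mu E - nu E <= D E.
  apply: ereal_sup_ubound; exists E => //.
  by apply: (sub_bounded_borel bE).
have h2 : D' E <= D K - (mu E - nu E).
  apply: ge_ereal_sup => _ [F bF <-]; have [mF FE _] := bF.
  have muF := bounded_fin mu bF; have nuF := bounded_fin nu bF.
  have bEF : bounded_borel K (E `\` F).
    apply: (sub_bounded_borel bE); first exact: measurableD.
      exact: subDsetl.
    exact: subset_trans EK.
  have muEF := bounded_fin mu bEF; have nuEF := bounded_fin nu bEF.
  have : mu (E `\` F) - nu (E `\` F) <= D K.
    by apply: ereal_sup_ubound; exists (E `\` F).
  rewrite (splitB mu E F)// (splitB nu E F)//.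
  rewrite -(fineK DK) -(fineK muF) -(fineK nuF) -(fineK muEF) -(fineK nuEF).
  by rewrite -!(EFinN, EFinD) !lee_fin; lra.
have h3 : D K = D E + D (K `\` E) by exact: splitB.
have h4 : rho K <= D' E + D (K `\` E).
  by rewrite (splitB rho K E)//; apply: leeD; [exact: rhon|exact: rhop].
move: h1 h2 h3 h4.
rewrite -(fineK DK) -(fineK muE) -(fineK nuE) -(fineK DE) -(fineK DKE).
rewrite -(fineK D'E) -(fineK rhoK) -!(EFinN, EFinD) !lee_fin => h1 h2 [h3] h4.
by rewrite /=; lra.
Qed.

Definition sradon_diff (mu nu : radon) : sradon :=
  SRadon (@radon_pos_part_ortho mu nu).

Lemma sradon_diffE (mu nu : radon) :
  radon_eq (radon_add (spos (sradon_diff mu nu)) nu)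
           (radon_add (sneg (sradon_diff mu nu)) mu).
Proof.
have H (m n : radon) K : ccompact K ->
    pos_part m n K + n K <= pos_part n m K + m K.
  move=> cK; have bK := ccompact_bounded cK; have mK := ccompact_measurable cK.
  rewrite -leeBrDr ?(bounded_fin _ bK)//; apply: ge_ereal_sup => _ [E bE <-].
  have [mE EK _] := bE.
  have mKE : measurable ((K : set (borel X)) `\` E) by exact: measurableD.
  have bKE : bounded_borel K (K `\` E).
    by apply: (sub_bounded_borel bK) => //; exact: subDsetl.
  have split_K (r : radon) : r K = r E + r (K `\` E).
    by rewrite -[in LHS](setDUK EK) measureU//; exact: setDIK.
  have := pos_part_le n m bKE; rewrite !split_K.
  move: (bounded_fin m bE) (bounded_fin n bE) (bounded_fin m bKE)
    (bounded_fin n bKE) (pos_part_ge0 n m K).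
  case: (pos_part n m K) => [d||] //=; last first.
    move=> mEf nEf mKEf nKEf _ _.
    case: (m E) mEf => // a _; case: (n E) nEf => // b _.
    case: (m (K `\` E)) mKEf => // c _; case: (n (K `\` E)) nKEf => // e _.
    by rewrite leey.
  case: (m E) => // a; case: (n E) => // b; case: (m (K `\` E)) => // c.
  case: (n (K `\` E)) => // e _ _ _ _ _.
  rewrite -!EFinD !lee_fin => h.
  by lra.
apply: radon_eq_ccompact => K cK; rewrite !radon_addE.
by apply/eqP; rewrite eq_le !H.
Qed.

Definition sradon_sub (m n : sradon) : sradon :=
  sradon_diff (radon_add (spos m) (sneg n)) (radon_add (sneg m) (spos n)).

Definition supp (mu : radon) : set X :=
  [set x | forall U : set X, open U -> U x -> 0 < mu U].

(* mu is carried by Q: the complement of Q is locally mu-negligible. *)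
Definition carried (mu : radon) (Q : set X) :=
  forall K : set X, ccompact K -> mu.-negligible (K `\` Q).

End radon.

Arguments radon0 {R X}.

Definition Psi (R : realType) (T : topologicalType) (f : T -> \bar R) :=
  [/\ lower_semicontinuous f, (forall x, -oo < f x) &
      compact [set: T] \/ (forall x, 0 <= f x)].

Section energy.
Context (R : realType) (X : ptopologicalType).
Variable kappa : X * X -> \bar R.

Definition is_kernel := Psi kappa /\ forall x y, kappa (x, y) = kappa (y, x).

Definition pot (mu : radon R X) (x : X) : \bar R :=
  \int[mu]_y kappa (x, y).

(* As kappa is in general not measurable for the product of the Borel
   sigma-algebras, the double integral is the iterated one; for a lower
   semicontinuous kappa and Radon measures it is the integral with respect to
   the Radon product of mu and nu. *)
Definition energy (mu nu : radon R X) : \bar R := \int[mu]_x pot nu x.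

(* Well defined unless both terms are infinite. *)
Definition spot (m : sradon R X) (x : X) : \bar R :=
  pot (spos m) x - pot (sneg m) x.

Definition senergy (m n : sradon R X) : \bar R :=
  (energy (spos m) (spos n) + energy (sneg m) (sneg n)) -
  (energy (spos m) (sneg n) + energy (sneg m) (spos n)).

Definition senergy_defined (m n : sradon R X) :=
  energy (spos m) (spos n) + energy (sneg m) (sneg n) \is a fin_num \/
  energy (spos m) (sneg n) + energy (sneg m) (spos n) \is a fin_num.

Definition strictly_positive_definite := forall m : sradon R X,
  senergy_defined m m ->
  0 <= senergy m m /\ (senergy m m = 0 -> sradon_is0 m).

(* The space E_kappa(X). *)
Definition finite_energy (m : sradon R X) :=
  [/\ energy (spos m) (spos m) \is a fin_num,
      energy (sneg m) (sneg m) \is a fin_num &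
      energy (spos m) (sneg m) \is a fin_num].

Definition knorm (m : sradon R X) : \bar R := sqrte (senergy m m).

(* Meaningful for Borel Q. Conventions: the infimum over the empty set is +oo,
   +oo^-1 = 0 and 0^-1 = +oo. *)
Definition capacity (Q : set X) : \bar R :=
  (ereal_inf [set energy mu mu | mu in [set mu : radon R X |
     [/\ energy mu mu \is a fin_num, carried mu Q & mu Q = 1]]])^-1.

Section condenser.
Context (I : finType).
Variables (A : I -> set X) (s : I -> R).

Definition plates (t : R) : set X := \bigcup_(i in [set i | s i = t]) A i.

Definition is_condenser :=
  [/\ (forall i, A i !=set0 /\ closed (A i)),
      (forall i, s i = 1%R \/ s i = (-1)%R) &
      capacity (plates 1 `&` plates (-1)) = 0].

(* M^+(A) *)
Definition condenser_measure (mu : I -> radon R X) :=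
  forall i, supp (mu i) `<=` A i.

(* E^+_kappa(A) *)
Definition condenser_finite_energy (mu : I -> radon R X) :=
  condenser_measure mu /\ forall i, energy (mu i) (mu i) < +oo.

(* R mu = \sum_i s_i mu^i as a signed Radon measure. *)
Definition Rmap (mu : I -> radon R X) : sradon R X :=
  sradon_diff (\big[@radon_add R X/radon0]_(i | s i == 1%R) mu i)
              (\big[@radon_add R X/radon0]_(i | s i == (-1)%R) mu i).

Definition venergy (mu : I -> radon R X) : \bar R :=
  \sum_i \sum_j (s i * s j)%:E * energy (mu i) (mu j).

(* The semimetric of E^+_kappa(A). *)
Definition condenser_dist (mu nu : I -> radon R X) : \bar R :=
  knorm (sradon_sub (Rmap mu) (Rmap nu)).

(* In the second alternative spot zeta is well defined outside a set that is null
   for every positive measure of finite energy, so that its value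
   elsewhere is irrelevant. *)
Definition external_field (f : I -> X -> \bar R) :=
  (forall i, Psi (f i)) \/
  exists2 zeta : sradon R X, finite_energy zeta &
    forall i x, f i x = (s i)%:E * spot zeta x.

Variables (f : I -> X -> \bar R) (a : I -> R) (g : I -> X -> R).
Variable sigma : I -> radon R X.

Definition gauss (mu : I -> radon R X) : \bar R :=
  venergy mu + 2%:E * \sum_i \int[mu i]_x f i x.

Definition is_constraint :=
  forall i, supp (sigma i) = A i /\ (a i)%:E < \int[sigma i]_x (g i x)%:E.

Definition admissible (mu : I -> radon R X) :=
  [/\ condenser_finite_energy mu,
      gauss mu \is a fin_num,
      (forall i, radon_le (mu i) (sigma i)) &
      (forall i, \int[mu i]_x (g i x)%:E = (a i)%:E)].

Definition gauss_inf : \bar R := ereal_inf [set gauss mu | mu in admissible].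

Definition solution (lam : I -> radon R X) :=
  admissible lam /\ gauss lam = gauss_inf.

End condenser.
End energy.

(* Main.v *)
Require Import Defs.
From mathcomp Require Import all_boot all_order all_algebra.
From mathcomp Require Import all_classical all_reals all_analysis.
From mathcomp Require Import measurable_realfun lra ring.
Import numFieldNormedType.Exports.
Import Order.TTheory GRing.Theory Num.Theory.

Local Open Scope classical_set_scope.
Local Open Scope ring_scope.
Local Open Scope ereal_scope.

(* The Gauss functional is a quadratic form plus a linear term, and the
   admissible class is convex. If lam and lam' are both minimizers, their
   midpoint is admissible, so the parallelogram law bounds the energy of
   R lam - R lam' by 0; strict positive definiteness then gives
   R lam = R lam'.
   The bilinearity of the energy rests on the measurability of potentials:
   the potential of a Radon measure is lower semicontinuous, by inner
   regularity and the tube lemma.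
   A measure of finite energy does not charge sets of zero capacity, so for
   essentially disjoint plates lam i is carried by A i minus the other plates,
   and can be read off R lam by restriction to that set. *)

Set Implicit Arguments.
Unset Strict Implicit.
Unset Printing Implicit Defensive.

(** * Integrals of functions with integrable negative part *)

Section maxe0.
Context (R : realType).
Implicit Types (a b : \bar R) (r : R).

Let max0 r : maxe r%:E 0 = (Num.max r 0)%:E. Proof. by rewrite EFin_max. Qed.
Let maxy : maxe (+oo : \bar R) 0 = +oo. Proof. by rewrite maxye. Qed.
Let maxNy : maxe (-oo : \bar R) 0 = 0. Proof. by rewrite maxNye. Qed.

(** Subtraction-free form of splitting a sum into positive and negative parts: no [+oo - +oo] can
    arise, and every term can be integrated as a nonnegative function. *)
Lemma maxe0D a b : -oo < a -> -oo < b ->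
  maxe (a + b) 0 + (maxe (- a) 0 + maxe (- b) 0) =
  maxe (- (a + b)) 0 + (maxe a 0 + maxe b 0).
Proof.
case: a b => [a||] [b||] //= _ _; rewrite ?max0 ?maxy ?maxNy -?EFinD
  ?addye ?addey ?max0 ?maxy ?maxNy -?EFinD ?addye ?addey//.
by congr EFin; rewrite /Order.max; do !case: ifPn; rewrite -?leNgt; lra.
Qed.

Lemma maxe0ND_le a b : -oo < a -> -oo < b ->
  maxe (- (a + b)) 0 <= maxe (- a) 0 + maxe (- b) 0.
Proof.
case: a b => [a||] [b||] //= _ _; rewrite ?max0 ?maxy ?maxNy -?EFinD
  ?lee_fin ?adde0 ?add0e//; rewrite ?lee_fin ?addr0 ?add0r ?le_max ?lexx ?orbT//.
by rewrite /Order.max; do !case: ifPn; rewrite -?leNgt; lra.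
Qed.

End maxe0.

Section integral_funeneg.
Context d (T : measurableType d) (R : realType).
Implicit Types (m : {measure set T -> \bar R}) (f g : T -> \bar R).

Lemma integral_funeneg_fin m f :
  -oo < \int[m]_x f x -> \int[m]_x f^\- x < +oo.
Proof.
rewrite integralE; case: (\int[m]_x f^\- x) => [r|/=|//]; first by rewrite ltry.
by rewrite addeNy ltxx.
Qed.

Lemma integral_gtNy m f : \int[m]_x f^\- x < +oo -> -oo < \int[m]_x f x.
Proof.
rewrite (integralE _ _ f) => fN.
have f0 : 0 <= \int[m]_x f^\- x by exact: integral_ge0.
have : 0 <= \int[m]_x f^\+ x by exact: integral_ge0.
move: f0 fN; case: (\int[m]_x f^\- x) => // r _ _.
by case: (\int[m]_x f^\+ x) => [r'||]// _; rewrite -?EFinN -?EFinD ltNyr.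
Qed.

(** Potentials and energies may equal [+oo], so integrability cannot be assumed. Integrating the
    identity [maxe0D] involves nonnegative functions only; the integrals of the negative parts are
    finite and can then be cancelled. *)
Lemma integralD_gtNy m f g : measurable_fun setT f -> measurable_fun setT g ->
  (forall x, -oo < f x) -> (forall x, -oo < g x) ->
  \int[m]_x f^\- x < +oo -> \int[m]_x g^\- x < +oo ->
  \int[m]_x (f x + g x) = \int[m]_x f x + \int[m]_x g x.
Proof.
move=> mf mg f_gt g_gt fN gN; pose h := f \+ g.
have mh : measurable_fun setT h by exact: emeasurable_funD.
have hE x : h^\+ x + (f^\- x + g^\- x) = h^\- x + (f^\+ x + g^\+ x).
  by rewrite !funeposE !funenegE; exact: maxe0D.
have mp (k : T -> \bar R) : measurable_fun setT k -> measurable_fun setT k^\+.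
  exact: measurable_funepos.
have mn (k : T -> \bar R) : measurable_fun setT k -> measurable_fun setT k^\-.
  exact: measurable_funeneg.
have [mfp mfn mgp mgn] := And4 (mp _ mf) (mn _ mf) (mp _ mg) (mn _ mg).
have mD (k l : T -> \bar R) : measurable_fun setT k -> measurable_fun setT l ->
    measurable_fun setT (fun x => k x + l x) by exact: emeasurable_funD.
have int2 k l : (forall x, 0 <= k x) -> (forall x, 0 <= l x) ->
    measurable_fun setT k -> measurable_fun setT l ->
    \int[m]_x (k x + l x) = \int[m]_x k x + \int[m]_x l x.
  by move=> *; rewrite ge0_integralD.
have intE : \int[m]_x h^\+ x + (\int[m]_x f^\- x + \int[m]_x g^\- x) =
    \int[m]_x h^\- x + (\int[m]_x f^\+ x + \int[m]_x g^\+ x).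
  rewrite -!int2//; [| solve [ by move=> *; apply: adde_ge0 | exact: mD
    | exact: mp | exact: mn ] ..].
  by apply: eq_integral => x _; exact: hE.
have hN : \int[m]_x h^\- x < +oo.
  apply: (@le_lt_trans _ _ (\int[m]_x (f^\- x + g^\- x))); last first.
    by rewrite ge0_integralD// lte_add_pinfty.
  apply: ge0_le_integral => //.
  - exact: mn.
  - exact: mD.
  by move=> x _; rewrite !funenegE; exact: maxe0ND_le.
rewrite ![\int[m]_x (_ + _)]integralE ![\int[m]_x f x]integralE ![\int[m]_x g x]integralE.
rewrite -/h.
have int_ge0 k : (forall x, 0 <= k x) -> 0 <= \int[m]_x k x.
  by move=> k0; exact: integral_ge0.
move: intE hN fN gN.
move: (int_ge0 h^\- (fun=> funeneg_ge0 _ _))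
  (int_ge0 f^\- (fun=> funeneg_ge0 _ _)) (int_ge0 g^\- (fun=> funeneg_ge0 _ _)).
move: (int_ge0 h^\+ (fun=> funepos_ge0 _ _))
  (int_ge0 f^\+ (fun=> funepos_ge0 _ _)) (int_ge0 g^\+ (fun=> funepos_ge0 _ _)).
case: (\int[m]_x h^\- x) => // a1; case: (\int[m]_x f^\- x) => // a2.
case: (\int[m]_x g^\- x) => // a3.
by case: (\int[m]_x h^\+ x) => [a4||] //; case: (\int[m]_x f^\+ x) => [a5||] //;
  case: (\int[m]_x g^\+ x) => [a6||] // _ _ _ _ _ _ + _ _ _;
  rewrite -?EFinN -?EFinD ?addye ?addey// -?EFinD => -[] ?; congr EFin; lra.
Qed.

Lemma integral_measure_add_gtNy m1 m2 f : measurable_fun setT f ->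
  \int[m1]_x f^\- x < +oo -> \int[m2]_x f^\- x < +oo ->
  \int[measure_add m1 m2]_x f x = \int[m1]_x f x + \int[m2]_x f x.
Proof.
move=> mf; rewrite !(integralE _ _ f) !ge0_integral_measure_add//; first last.
- exact: measurable_funepos.
- exact: measurable_funeneg.
have int_ge0 m k : (forall x, 0 <= k x) -> 0 <= \int[m]_x k x.
  by move=> k0; exact: integral_ge0.
move: (int_ge0 m1 f^\- (fun=> funeneg_ge0 _ _)) (int_ge0 m2 f^\- (fun=> funeneg_ge0 _ _)).
move: (int_ge0 m1 f^\+ (fun=> funepos_ge0 _ _)) (int_ge0 m2 f^\+ (fun=> funepos_ge0 _ _)).
case: (\int[m1]_x f^\- x) => // a1; case: (\int[m2]_x f^\- x) => // a2.
case: (\int[m1]_x f^\+ x) => [a3||]//; case: (\int[m2]_x f^\+ x) => [a4||]// _ _ _ _ _ _.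
by rewrite -!(EFinN, EFinD); congr EFin; lra.
Qed.

Lemma integral_mscale_gtNy m (k : {nonneg R}) f : measurable_fun setT f ->
  \int[m]_x f^\- x < +oo ->
  \int[mscale k m]_x f x = (k%:num)%:E * \int[m]_x f x.
Proof.
move=> mf; rewrite !(integralE _ _ f) !ge0_integral_mscale//; first last.
- exact: measurable_funepos.
- exact: measurable_funeneg.
move=> fN; rewrite [RHS]muleBr//; apply: fin_num_adde_defl.
rewrite fin_numN ge0_fin_numE//.
exact: integral_ge0.
Qed.

Lemma integralZl_gtNy m f (k : R) : (0 <= k)%R ->
  measurable_fun setT f -> \int[m]_x f^\- x < +oo ->
  \int[m]_x (k%:E * f x) = k%:E * \int[m]_x f x.
Proof.
move=> k0 mf fN; rewrite (integralE _ _ (fun x => k%:E * f x)) (integralE _ _ f).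
rewrite ge0_funeposM// ge0_funenegM// !ge0_integralZl//; first last.
- exact: measurable_funepos.
- exact: measurable_funeneg.
rewrite [RHS]muleBr//; apply: fin_num_adde_defl.
by rewrite fin_numN ge0_fin_numE//; exact: integral_ge0.
Qed.

End integral_funeneg.

(** * Radon measures *)

Section radon_operations.
Context (R : realType) (X : ptopologicalType).
Implicit Types (mu nu : radon R X).

Lemma radon_scale_subproof mu (k : {nonneg R}) : is_radon (mscale k mu).
Proof.
split=> [K cK|B mB].
  by rewrite /mscale lte_mul_pinfty// (radonP mu).1.
rewrite {1}/mscale (radonP mu).2// -ereal_supZl//; last first.
  by apply/set0P; exists (mu set0), set0 => //; split=> //; exact: ccompact_set0.
congr ereal_sup; apply/seteqP; split=> [_ [_ [K ? <-] <-]|_ [K ? <-]].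
  by exists K.
by exists (mu K) => //; exists K.
Qed.

Definition radon_scale mu (k : {nonneg R}) : radon R X :=
  Radon (radon_scale_subproof mu k).

Lemma radon_restr_subproof mu (D : set (borel X)) (mD : measurable D) :
  is_radon (mrestr mu mD).
Proof.
have mI B : measurable B -> measurable (B `&` D) by move=> mB; exact: measurableI.
split=> [K cK|B mB].
  apply: le_lt_trans ((radonP mu).1 _ cK); rewrite /mrestr.
  by apply: le_measure; rewrite ?inE//; [apply: mI|]; exact: ccompact_measurable.
apply/eqP; rewrite eq_le; apply/andP; split.
  rewrite {1}/mrestr (radonP mu).2; last exact: mI.
  apply: ge_ereal_sup => _ [K [cK KB] <-]; apply: ereal_sup_ubound.
  exists K; first by split=> // x /KB[].
  by rewrite /mrestr; congr (mu _); apply/seteqP; split=> x;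
    [case|move=> Kx; split=> //; case: (KB _ Kx)].
apply: ge_ereal_sup => _ [K [cK KB] <-]; rewrite /mrestr.
apply: le_measure; rewrite ?inE; [by apply: mI; exact: ccompact_measurable|exact: mI|].
exact: setSI.
Qed.

Definition radon_restr mu (D : set (borel X)) (mD : measurable D) : radon R X :=
  Radon (radon_restr_subproof mu mD).

Lemma radon_finite mu : compact [set: X] -> mu setT < +oo.
Proof.
by move=> cX; apply: (radonP mu).1; split=> //; exact: closedT.
Qed.

(* On a compact space every Radon measure is finite; elsewhere only c = 0 keeps
   the integral of the negative part finite. *)
Definition tame (f : X -> \bar R) :=
  measurable_fun [set: borel X] f /\
  exists2 c : R, (0 <= c)%R &
    (forall x, (- c)%:E <= f x) /\ (compact [set: X] \/ c = 0%R).

Lemma tame_gtNy f x : tame f -> -oo < f x.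
Proof. by move=> [_ [c _ [fc _]]]; exact: lt_le_trans (ltNyr _) (fc x). Qed.

Lemma integral_tame_funeneg mu f : tame f -> \int[mu]_x f^\- x < +oo.
Proof.
move=> [mf [c c0 [fc cX]]].
apply: (@le_lt_trans _ _ (\int[mu]_x (cst c%:E x))).
  apply: ge0_le_integral => //.
  - exact: measurable_funeneg.
  by move=> x _ /=; rewrite funenegE ge_max lee_fin c0 leeNl -EFinN fc.
rewrite integral_cst//; case: cX => [cX|->]; last by rewrite mul0e.
by rewrite lte_mul_pinfty// radon_finite.
Qed.

Lemma integral_tame_gtNy mu f : tame f -> -oo < \int[mu]_x f x.
Proof. by move=> tf; apply: integral_gtNy; exact: integral_tame_funeneg. Qed.

Lemma integral_tameD mu f g : tame f -> tame g ->
  \int[mu]_x (f x + g x) = \int[mu]_x f x + \int[mu]_x g x.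
Proof.
move=> tf tg; apply: integralD_gtNy; [exact: tf.1|exact: tg.1|..].
- by move=> x; exact: tame_gtNy.
- by move=> x; exact: tame_gtNy.
- exact: integral_tame_funeneg.
- exact: integral_tame_funeneg.
Qed.

Lemma integral_radon_addE mu nu (f : X -> \bar R) :
  measurable_fun [set: borel X] f ->
  -oo < \int[mu]_x f x -> -oo < \int[nu]_x f x ->
  \int[radon_add mu nu]_x f x = \int[mu]_x f x + \int[nu]_x f x.
Proof.
move=> mf /integral_funeneg_fin fm /integral_funeneg_fin fn.
exact: integral_measure_add_gtNy.
Qed.

Lemma integral_radon_scaleE mu k (f : X -> \bar R) :
  measurable_fun [set: borel X] f -> -oo < \int[mu]_x f x ->
  \int[radon_scale mu k]_x f x = k%:num%:E * \int[mu]_x f x.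
Proof.
by move=> mf /integral_funeneg_fin fm; exact: integral_mscale_gtNy.
Qed.

Lemma eq_radon_integral mu nu (f : X -> \bar R) : radon_eq mu nu ->
  \int[mu]_x f x = \int[nu]_x f x.
Proof. by move=> mn; apply: eq_measure_integral => B mB _; exact: mn. Qed.

End radon_operations.

(** * Lower semicontinuous functions *)

Section lower_semicontinuity.
Context (R : realType) (X : ptopologicalType).

Lemma lsc_measurable (f : X -> \bar R) : lower_semicontinuous f ->
  measurable_fun [set: borel X] f.
Proof.
move=> /lower_semicontinuousP fo.
apply: (measurability _ (ErealGenOInfty.measurableE R)).
move=> /= _ [_ [a ->]] <-; rewrite setTI preimage_itvoy.
by apply: sub_sigma_algebra; exact: fo.
Qed.

(** The open sets where [f > - n] increase with [n] and cover the compact space, so a single [n]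
    suffices. *)
Lemma lsc_bounded_below (T : topologicalType) (f : T -> \bar R) :
  compact [set: T] -> lower_semicontinuous f -> (forall x, -oo < f x) ->
  exists2 c : R, (0 <= c)%R & forall x, (- c)%:E <= f x.
Proof.
move=> /compact_near_coveringP cT lf fNy.
have [N _ HN] : \forall n \near \oo, [set: T] `<=` (fun x => (- n%:R)%:E <= f x).
  apply: cT => x _.
  have [n fx] : exists n, (- n%:R)%:E < f x.
    move: (fNy x); case: (f x) => [r||] // _; last by exists 0%N; rewrite ltry.
    by exists (Num.truncn (- r)).+1; rewrite lte_fin ltrNl truncnS_gt.
  have [V Vx HV] := lf _ _ fx.
  near=> y m => /=; apply: ltW; apply: le_lt_trans (HV y _); last by near: y.
  by rewrite lee_fin lerN2 ler_nat; near: m; exact: nbhs_infty_ge.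
by exists N%:R => // x; apply: (HN N) => //=.
Unshelve. all: by end_near.
Qed.

Lemma Psi_tame (f : X -> \bar R) : Psi f -> tame f.
Proof.
move=> [lf fNy [cX|f0]]; (split; first exact: lsc_measurable).
  have [c c0 fc] := lsc_bounded_below cX lf fNy.
  by exists c => //; split => //; left.
by exists 0%R => //; split; [rewrite oppr0|right].
Qed.

End lower_semicontinuity.

(** * Lower semicontinuity of potentials *)

Lemma lteD_split (R : realType) (t : R) (a b : \bar R) :
  0 <= a -> 0 <= b -> t%:E < a + b ->
  exists t1 t2 : R, [/\ t1%:E < a, t2%:E < b & (t <= t1 + t2)%R].
Proof.
case: a b => [a||] [b||] //; rewrite ?lee_fin => a0 b0.
- rewrite -EFinD lte_fin => tab; pose e := ((a + b - t) / 2)%R.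
  by exists (a - e)%R, (b - e)%R; split; rewrite ?lte_fin /e; lra.
- by move=> _; exists (a - 1)%R, (t - a + 1)%R; split; rewrite ?lte_fin ?ltry//; lra.
- by move=> _; exists (t - b + 1)%R, (b - 1)%R; split; rewrite ?lte_fin ?ltry//; lra.
- by move=> _; exists 0%R, t; split; rewrite ?ltry//; lra.
Qed.

(** Lower semicontinuity of finite sums, with the bound [u j] kept apart from the value [F j x]: in
    [lsc_integral], [u j] is a term of the integral of a simple function lying below the kernel. *)
Lemma near_sum_lt (R : realType) (X : topologicalType) (J : Type) (s : seq J)
    (u : J -> \bar R) (F : J -> X -> \bar R) (x : X) : (forall j, 0 <= u j) ->
  (forall j t, t%:E < u j -> \forall x' \near x, t%:E < F j x') ->
  forall t, t%:E < \sum_(j <- s) u j ->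
  \forall x' \near x, t%:E < \sum_(j <- s) F j x'.
Proof.
move=> u0 uF; elim: s => [|j s IHs] t.
  by rewrite big_nil => t0; near=> x'; rewrite big_nil.
rewrite big_cons => /lteD_split[//||t1 [t2 [t1u t2u tt12]]].
  exact: sume_ge0.
near=> x'; rewrite big_cons; apply: (@le_lt_trans _ _ (t1%:E + t2%:E)).
  by rewrite -EFinD lee_fin.
by apply: lteD; [near: x'; exact: uF|near: x'; exact: IHs].
Unshelve. all: by end_near. Qed.

Section lsc_potential.
Import HBNNSimple.
Context (R : realType) (X : ptopologicalType).
Variable k : X * X -> \bar R.
Hypothesis lsck : lower_semicontinuous k.
Hypothesis k0 : forall z, 0 <= k z.
Implicit Types (nu : radon R X) (t : R).

Lemma lsc_section x : lower_semicontinuous (fun y => k (x, y)).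
Proof.
move=> y a /lsck[V [[/= P Q] [/= xP yQ] PQV] HV].
by exists Q => // z Qz; apply: HV; apply: PQV; split=> //=; exact: nbhs_singleton.
Qed.

(** The inequality is an open condition around each point of [{x} * K]; compactness of [K] makes the
    neighbourhood of [x] uniform in [y]. *)
Lemma lsc_tube (x : X) (K : set X) t : compact K ->
  (forall y, K y -> t%:E < k (x, y)) ->
  \forall x' \near x, forall y, K y -> t%:E < k (x', y).
Proof.
move=> /compact_near_coveringP cK kK.
apply: (cK _ _ (fun x' y => t%:E < k (x', y))) => y Ky.
have [V [[/= P Q] [/= xP yQ] PQV] HV] := lsck (kK _ Ky).
by near=> y' x' => /=; apply: HV; apply: PQV; split=> /=; [near: x'|near: y'].
Unshelve. all: by end_near. Qed.

Lemma measurable_section x : measurable_fun [set: borel X] (fun y => k (x, y)).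
Proof. by apply: (@lsc_measurable R X (fun y => k (x, y))); exact: lsc_section. Qed.

(* Inner regularity reduces the claim to a compact set, where the tube lemma
   applies. *)
Lemma near_integral_gt nu (B : set (borel X)) (x : X) (r : R) : measurable B ->
  (0 <= r)%R -> (forall y, B y -> r%:E <= k (x, y)) ->
  forall t, t%:E < r%:E * nu B ->
  \forall x' \near x, t%:E < \int[nu]_(y in B) k (x', y).
Proof.
(* For negative [t] nonnegativity of the integral is enough; in the remaining case [0 <= t] makes
   the constant [c] below nonnegative. *)
move=> mB r0 rk t; have [t0 _|t0] := ltP t 0%R.
  near=> x'; apply: (@lt_le_trans _ _ 0); first by rewrite lte_fin.
  by apply: integral_ge0.
rewrite (radonP nu).2// => trB.
have [K [cK KB] tK] : exists2 K : set X, ccompact K /\ K `<=` B & t%:E < r%:E * nu K.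
  move: trB; rewrite -ereal_supZl//; last first.
    by apply/set0P; exists (nu set0), set0 => //; split=> //; exact: ccompact_set0.
  by move=> /ereal_sup_gt[_ [_ [K KP <-] <-] tK]; exists K.
have mK := ccompact_measurable cK.
have nuK : nu K \is a fin_num by exact: bounded_fin (ccompact_bounded cK).
set m := fine (nu K); have nuKE : nu K = m%:E by rewrite /m fineK.
have trm : (t < r * m)%R by rewrite -lte_fin EFinM -nuKE.
have m_gt0 : (0 < m)%R.
  rewrite lt_neqAle fine_ge0// andbT; apply/eqP => m0.
  by move: trm; rewrite -m0 mulr0; lra.
(* [c] lies strictly between [t / m] and [r]: below [r], so that [k (x, y) > c] on [K] and the tube
   lemma applies; above [t / m], so that [c * m] still exceeds [t]. *)
pose c := ((r + t / m) / 2)%R.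
have tmr : (t / m < r)%R by rewrite ltr_pdivrMr.
have tm0 : (0 <= t / m)%R by rewrite divr_ge0// ltW.
have cr : (c < r)%R by rewrite /c; lra.
have tcm : (t < c * m)%R by rewrite -ltr_pdivrMr// /c; lra.
have near_c : \forall x' \near x, forall y, K y -> c%:E < k (x', y).
  apply: lsc_tube cK.1 _ => y /KB /rk; apply: lt_le_trans.
  by rewrite lte_fin.
near=> x'; apply: (@lt_le_trans _ _ (\int[nu]_(y in K) (cst c%:E y))).
  by rewrite integral_cst// nuKE -EFinM lte_fin.
apply: (@le_trans _ _ (\int[nu]_(y in K) k (x', y))); last first.
  apply: ge0_subset_integral => //.
  by apply: measurable_funTS; exact: measurable_section.
have cx' : forall y, K y -> c%:E < k (x', y) by near: x'.
apply: ge0_le_integral => //.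
- by move=> y _; rewrite lee_fin /c; lra.
- by apply: measurable_funTS; exact: measurable_section.
- by move=> y Ky; exact/ltW/cx'.
Unshelve. all: by end_near. Qed.

(** The simple functions below [k (x, _)] depend on [x], so this is no mere supremum of lower
    semicontinuous functions. One simple function [h] with integral above [t] is fixed, and
    [near_integral_gt] is applied on each of its finitely many level sets. *)
Lemma lsc_integral nu : lower_semicontinuous (fun x => \int[nu]_y k (x, y)).
Proof.
move=> x t; rewrite ge0_integralTE// => /ereal_sup_gt[_ [h hk <-]].
rewrite sintegralE fsbig_finite//=.
move=> th.
set s := finmap.enum_fset _ in th; have us : uniq s by exact: finmap.fset_uniq.
have preim r : measurable (h @^-1` [set r]) by exact: measurable_funPTI.
(* The level sets are disjoint, so the integrals over them add up to at most the whole integral. *)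
suff near_t : \forall x' \near x,
    t%:E < \sum_(r <- s) \int[nu]_(y in h @^-1` [set r]) k (x', y).
  exists [set x' | t%:E < \sum_(r <- s) \int[nu]_(y in h @^-1` [set r]) k (x', y)] => //.
  move=> x' /= /lt_le_trans; apply; rewrite -ge0_integral_bigsetU//.
  - apply: ge0_subset_integral => //; last exact: measurable_section.
    exact: bigsetU_measurable.
  - exact: trivIset_preimage1.
  - by apply: measurable_funTS; exact: measurable_section.
apply: near_sum_lt th => [r|r {}t th].
  have [r0|r0] := leP 0%R r; first by rewrite mule_ge0.
  rewrite (_ : h @^-1` _ = set0) ?measure0 ?mule0//.
  by apply/seteqP; split=> // y /= hy; move: r0; rewrite -hy ltNge fun_ge0.
have [r0|r0] := leP 0%R r; last first.
  move: th; rewrite (_ : h @^-1` _ = set0) ?measure0 ?mule0.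
    by move=> t0; near=> x'; rewrite integral_set0.
  by apply/seteqP; split=> // y /= hy; move: r0; rewrite -hy ltNge fun_ge0.
by apply: near_integral_gt th => // y /= <-; exact: hk.
Unshelve. all: by end_near. Qed.

End lsc_potential.

(** * Bilinearity of the mutual energy *)

Section mutual_energy.
Context (R : realType) (X : ptopologicalType).
Variable kappa : X * X -> \bar R.
Hypothesis Psi_kappa : Psi kappa.
Implicit Types (mu nu rho : radon R X).
Local Notation E := (energy kappa).

(** [Psi kappa] speaks of compactness of the product; [X] is its image under the first
    projection. *)
Lemma kernel_bounded_below : exists2 c : R, (0 <= c)%R &
  (forall z, (- c)%:E <= kappa z) /\ (compact [set: X] \/ c = 0%R).
Proof.
have [lk kNy [cXX|k0]] := Psi_kappa.
  have [c c0 kc] := lsc_bounded_below cXX lk kNy.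
  exists c => //; split=> //; left.
  rewrite (_ : [set: X] = fst @` [set: X * X]).
    apply: continuous_compact => //; apply: continuous_subspaceT => x.
    exact: cvg_fst.
  by apply/seteqP; split=> x // _; exists (x, x).
by exists 0%R => //; split; [rewrite oppr0|right].
Qed.

Lemma tame_section x : tame (fun y => kappa (x, y)).
Proof.
have [lk _ _] := Psi_kappa; have [c c0 [kc cX]] := kernel_bounded_below.
split; last by exists c => //; split.
by apply: (@lsc_measurable R X (fun y => kappa (x, y))); exact: lsc_section.
Qed.

(** [lsc_integral] requires a nonnegative kernel, hence the shift of [kappa] by [c]. On a compact
    space [nu] is finite and the shift changes the potential by the finite constant [d], which is
    [c] times the total mass; otherwise [c = 0] and nothing changes. *)
Lemma tame_pot nu : tame (pot kappa nu).
Proof.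
have [lk kNy _] := Psi_kappa; have [c c0 [kc cX]] := kernel_bounded_below.
pose k z := kappa z + c%:E.
have lk' : lower_semicontinuous k.
  move=> z a; rewrite /k -lteBlDr// -EFinB => /lk[V Vz HV]; exists V => // w Vw.
  by rewrite /k -lteBlDr// -EFinB; exact: HV.
have k0 z : 0 <= k z by rewrite /k -leeBlDr// sub0e -EFinN.
have tcst (r : R) : (r = c \/ r = - c)%R -> @tame R X (fun=> r%:E).
  move=> rc; split; first exact: measurable_cst.
  by exists c => //; split=> // x; rewrite lee_fin; case: rc => ->; lra.
have [d d0 [cd dX]] : exists2 d : R, (0 <= d)%R &
    c%:E * nu setT = d%:E /\ (compact [set: X] \/ d = 0%R).
  case: cX => [cX|->]; last by exists 0%R => //; rewrite mul0e; split=> //; right.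
  have nuX : nu setT \is a fin_num by rewrite ge0_fin_numE// radon_finite.
  exists (c * fine (nu setT))%R; first by rewrite mulr_ge0// fine_ge0.
  by split; [rewrite EFinM fineK|left].
have potE x : pot kappa nu x = \int[nu]_y k (x, y) - d%:E.
  rewrite /pot (@integral_tameD _ _ nu (fun y => kappa (x, y)) (fun=> c%:E)).
  - by rewrite integral_cst// cd addeK.
  - exact: tame_section.
  - by apply: tcst; left.
split.
  rewrite (_ : pot kappa nu = fun x => \int[nu]_y k (x, y) - d%:E); last exact/funext.
  apply: emeasurable_funB; last exact: measurable_cst.
  apply: (@lsc_measurable R X (fun x => \int[nu]_y k (x, y))); exact: lsc_integral.
exists d => //; split=> // x; rewrite potE EFinN -[leLHS]add0e; apply: leeD => //.
exact: integral_ge0.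
Qed.

Lemma energy_gtNy mu nu : -oo < E mu nu.
Proof. by apply: integral_tame_gtNy; exact: tame_pot. Qed.

Lemma eq_energy mu mu' nu nu' : radon_eq mu mu' -> radon_eq nu nu' ->
  E mu nu = E mu' nu'.
Proof.
move=> mm nn; rewrite /energy (eq_radon_integral _ mm); apply: eq_integral => x _.
exact: eq_radon_integral.
Qed.

Lemma energyDl mu mu' nu : E (radon_add mu mu') nu = E mu nu + E mu' nu.
Proof.
apply: integral_radon_addE; first exact: (tame_pot nu).1.
  exact: energy_gtNy.
exact: energy_gtNy.
Qed.

Lemma pot_add mu nu x :
  pot kappa (radon_add mu nu) x = pot kappa mu x + pot kappa nu x.
Proof.
apply: integral_radon_addE; first exact: (tame_section x).1.
  exact: integral_tame_gtNy (tame_section x).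
exact: integral_tame_gtNy (tame_section x).
Qed.

Lemma energyDr mu nu nu' : E mu (radon_add nu nu') = E mu nu + E mu nu'.
Proof.
rewrite /energy -integral_tameD; [|exact: tame_pot|exact: tame_pot].
by apply: eq_integral => x _; exact: pot_add.
Qed.

Lemma energyZl mu nu k : E (radon_scale mu k) nu = k%:num%:E * E mu nu.
Proof.
apply: integral_radon_scaleE; first exact: (tame_pot nu).1.
exact: energy_gtNy.
Qed.

Lemma energyZr mu nu k : E mu (radon_scale nu k) = k%:num%:E * E mu nu.
Proof.
rewrite /energy -integralZl_gtNy//; last 2 first.
- exact: (tame_pot nu).1.
- exact: integral_tame_funeneg (tame_pot nu).
apply: eq_integral => x _; apply: integral_radon_scaleE.
  exact: (tame_section x).1.
exact: integral_tame_gtNy (tame_section x).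
Qed.

Lemma energy0l nu : E radon0 nu = 0.
Proof. exact: integral_measure_zero. Qed.

Lemma energy0r mu : E mu radon0 = 0.
Proof.
by rewrite /energy (eq_integral (cst 0)) ?integral0// => x _;
  exact: integral_measure_zero.
Qed.

End mutual_energy.

(** * Order and cancellation of Radon measures *)

Section radon_order.
Context (R : realType) (X : ptopologicalType).
Implicit Types (mu nu rho : radon R X).

Lemma radon_ccompact_fin mu (K : set X) : ccompact K -> mu K \is a fin_num.
Proof. by move=> cK; exact: bounded_fin (ccompact_bounded cK). Qed.

Lemma radon_eq_trans mu nu rho : radon_eq mu nu -> radon_eq nu rho ->
  radon_eq mu rho.
Proof. by move=> mn nr B mB; rewrite mn// nr. Qed.

Lemma radon_addACA mu mu' nu nu' :
  radon_eq (radon_add (radon_add mu mu') (radon_add nu nu'))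
           (radon_add (radon_add mu nu) (radon_add mu' nu')).
Proof. by move=> B mB; rewrite !radon_addE addeACA. Qed.

Lemma eq_radon_add mu mu' nu nu' : radon_eq mu nu -> radon_eq mu' nu' ->
  radon_eq (radon_add mu mu') (radon_add nu nu').
Proof. by move=> mn mn' B mB; rewrite !radon_addE mn// mn'. Qed.

(** The complement is taken as [(nu - mu)^+], since [nu - mu] has no meaning on sets of infinite
    measure. On a compact [K] everything is finite, and [mu <= nu] outside [B] shows that the
    supremum is attained at [K] itself. *)
Lemma radon_le_add mu nu : radon_le mu nu ->
  exists rho, radon_eq nu (radon_add mu rho).
Proof.
move=> mn; exists (radon_pos_part nu mu); apply: radon_eq_ccompact => K cK.
have bK := ccompact_bounded cK; have mK := ccompact_measurable cK.
have nK := radon_ccompact_fin nu cK; have uK := radon_ccompact_fin mu cK.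
rewrite radon_addE /=; suff -> : pos_part nu mu K = nu K - mu K.
  by rewrite addeC subeK.
apply/eqP; rewrite eq_le; apply/andP; split; last first.
  by apply: ereal_sup_ubound; exists K.
apply: ge_ereal_sup => _ [B bB <-]; have [mB BK _] := bB.
have mKB : measurable ((K : set (borel X)) `\` B) by exact: measurableD.
have bKB : bounded_borel K (K `\` B).
  by apply: (sub_bounded_borel bK) => //; exact: subDsetl.
have splitK (r : radon R X) : r K = r B + r (K `\` B).
  by rewrite -[in LHS](setDUK BK) measureU//; exact: setDIK.
have := mn _ mKB; rewrite !splitK.
rewrite -(fineK (bounded_fin nu bB)) -(fineK (bounded_fin mu bB)).
rewrite -(fineK (bounded_fin nu bKB)) -(fineK (bounded_fin mu bKB)).
by rewrite -!(EFinN, EFinD) !lee_fin; lra.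
Qed.

Lemma radon_pos_part_le mu nu : radon_le (radon_pos_part mu nu) mu.
Proof.
move=> B mB; apply: ge_ereal_sup => _ [C bC <-].
have [mC CB _] := bC; rewrite leeBlDr ?(bounded_fin _ bC)//.
by apply: (@le_trans _ _ (mu B)); rewrite ?leeDl//; apply: le_measure; rewrite ?inE.
Qed.

(** Subtraction is legitimate on compact sets, where [rho] is finite, and compact sets determine a
    Radon measure. *)
Lemma radon_addr_inj mu nu rho :
  radon_eq (radon_add mu rho) (radon_add nu rho) -> radon_eq mu nu.
Proof.
move=> mnr; apply: radon_eq_ccompact => K cK.
have := mnr _ (ccompact_measurable cK); rewrite !radon_addE.
have rK := radon_ccompact_fin rho cK.
by move=> /(congr1 (fun x => x - rho K)); rewrite !addeK.
Qed.

(** [rho] is the lattice meet of [mu] and [nu]. It links a difference to its Jordan parts by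
    addition alone, so that finiteness of energies and identities between them can be
    transferred. *)
Lemma sradon_diff_common mu nu : exists rho,
  radon_eq mu (radon_add (spos (sradon_diff mu nu)) rho) /\
  radon_eq nu (radon_add (sneg (sradon_diff mu nu)) rho).
Proof.
have [rho muE] := radon_le_add (radon_pos_part_le mu nu).
exists rho; split=> //; apply: (@radon_addr_inj _ _ (radon_pos_part mu nu)) => B mB.
have := sradon_diffE mu nu mB; rewrite !radon_addE /= => D.
by rewrite addeC D (muE _ mB) radon_addE -[RHS]addeA [X in _ = _ + X]addeC.
Qed.

Lemma radon_restrK mu (D : set (borel X)) (mD : measurable D) :
  radon_eq mu (radon_add (radon_restr mu mD) (radon_restr mu (measurableC mD))).
Proof.
move=> B mB; rewrite radon_addE /= /mrestr -measureU//; last 3 first.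
- exact: measurableI.
- by apply: measurableI => //; exact: measurableC.
- by rewrite setIACA setICr setI0.
by rewrite -setIUr setUCr setIT.
Qed.

End radon_order.

(** If [c] or [d] were [+oo], the difference would be [-oo]. *)
Lemma fin_num_sube_ge0 (R : realType) (a b c d : \bar R) :
  a \is a fin_num -> b \is a fin_num -> -oo < c -> -oo < d ->
  0 <= a + b - (c + d) -> c \is a fin_num /\ d \is a fin_num.
Proof. by case: a b c d => [a||] [b||] [c||] [d||]. Qed.

(** * Measures of finite energy, energy of differences, zero capacity *)

Section finite_energy.
Context (R : realType) (X : ptopologicalType).
Variable kappa : X * X -> \bar R.
Hypothesis Psi_kappa : Psi kappa.
Hypothesis spd : strictly_positive_definite (R := R) kappa.
Implicit Types (mu nu rho : radon R X).
Local Notation E := (energy kappa).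
Local Notation has_energy mu := (E mu mu \is a fin_num).

Lemma energyDD m1 m2 n1 n2 : E (radon_add m1 m2) (radon_add n1 n2) =
  E m1 n1 + E m1 n2 + (E m2 n1 + E m2 n2).
Proof. by rewrite energyDl// (energyDr _ m1)// (energyDr _ m2). Qed.

Lemma energyDD_fin m1 m2 n1 n2 :
  E (radon_add m1 m2) (radon_add n1 n2) \is a fin_num =
  [&& E m1 n1 \is a fin_num, E m1 n2 \is a fin_num,
      E m2 n1 \is a fin_num & E m2 n2 \is a fin_num].
Proof.
have fin4 (a b c d : \bar R) : a + b + (c + d) \is a fin_num =
    [&& a \is a fin_num, b \is a fin_num, c \is a fin_num & d \is a fin_num].
  by rewrite !fin_numD -!andbA.
by rewrite energyDD fin4.
Qed.

Lemma has_energy_addl mu nu : has_energy (radon_add mu nu) ->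
  [/\ has_energy mu, E mu nu \is a fin_num,
      E nu mu \is a fin_num & has_energy nu].
Proof.
by rewrite energyDD_fin => /and4P.
Qed.

Lemma has_energy_eq mu nu : radon_eq mu nu -> has_energy mu -> has_energy nu.
Proof. by move=> mn; rewrite (eq_energy kappa mn mn). Qed.

(** The Jordan parts of [mu - nu] are summands of [mu] and [nu], so they have finite energy and the
    energy of [mu - nu] is defined. Its being nonnegative excludes an infinite mutual energy of the
    two parts; the terms with the common part [rho] are finite as summands of the energies of [mu]
    and [nu]. *)
Lemma mutual_energy_fin mu nu : has_energy mu -> has_energy nu ->
  E mu nu \is a fin_num.
Proof.
have [rho [muE nuE]] := sradon_diff_common mu nu.
set D := sradon_diff mu nu in muE nuE *.
move=> /(has_energy_eq muE)/has_energy_addl[pp pr rp rr].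
move=> /(has_energy_eq nuE)/has_energy_addl[nn nr rn _].
have [] := spd (m := D).
  by left; rewrite fin_numD pp.
move=> /(fin_num_sube_ge0 pp nn (energy_gtNy Psi_kappa _ _)
  (energy_gtNy Psi_kappa _ _))[pn np] _.
by rewrite (eq_energy kappa muE nuE) energyDD_fin pn pr rn rr.
Qed.

Lemma has_energyD mu nu : has_energy mu -> has_energy nu ->
  has_energy (radon_add mu nu).
Proof.
by move=> mm nn; rewrite energyDD_fin mm nn (mutual_energy_fin mm nn) mutual_energy_fin.
Qed.

Definition fenergy mu nu : R := fine (E mu nu).
Local Notation e := fenergy.

Lemma fenergyK mu nu : has_energy mu -> has_energy nu -> E mu nu = (e mu nu)%:E.
Proof. by move=> mm nn; rewrite fineK// mutual_energy_fin. Qed.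

Lemma fenergyDl mu nu rho : has_energy mu -> has_energy nu -> has_energy rho ->
  e (radon_add mu nu) rho = (e mu rho + e nu rho)%R.
Proof.
move=> hm hn hr; rewrite /e energyDl//.
by rewrite (fineD (mutual_energy_fin hm hr) (mutual_energy_fin hn hr)).
Qed.

Lemma fenergyDr mu nu rho : has_energy mu -> has_energy nu -> has_energy rho ->
  e rho (radon_add mu nu) = (e rho mu + e rho nu)%R.
Proof.
move=> hm hn hr; rewrite /e energyDr//.
by rewrite (fineD (mutual_energy_fin hr hm) (mutual_energy_fin hr hn)).
Qed.

Lemma eq_fenergy mu mu' nu nu' : radon_eq mu mu' -> radon_eq nu nu' ->
  e mu nu = e mu' nu'.
Proof. by move=> mm nn; rewrite /fenergy (eq_energy kappa mm nn). Qed.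

Lemma fenergyDD m1 m2 n1 n2 : has_energy m1 -> has_energy m2 ->
  has_energy n1 -> has_energy n2 ->
  e (radon_add m1 m2) (radon_add n1 n2) =
  (e m1 n1 + e m1 n2 + (e m2 n1 + e m2 n2))%R.
Proof.
move=> hm1 hm2 hn1 hn2; rewrite fenergyDl//; last exact: has_energyD.
by rewrite (fenergyDr (rho := m1))// (fenergyDr (rho := m2)).
Qed.

(** The energy of [mu - nu], computed from any pair of positive measures of finite energy with that
    difference and not only from the Jordan parts; [denergyDD] gives the invariance. *)
Definition denergy mu nu : R := (e mu mu + e nu nu - (e mu nu + e nu mu))%R.

Lemma eq_denergy mu mu' nu nu' : radon_eq mu mu' -> radon_eq nu nu' ->
  denergy mu nu = denergy mu' nu'.
Proof.
move=> mm nn; rewrite /denergy (eq_fenergy mm mm) (eq_fenergy nn nn).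
by rewrite (eq_fenergy mm nn) (eq_fenergy nn mm).
Qed.

Lemma denergyDD mu nu rho : has_energy mu -> has_energy nu -> has_energy rho ->
  denergy (radon_add mu rho) (radon_add nu rho) = denergy mu nu.
Proof.
move=> hm hn hr; rewrite /denergy !fenergyDD//.
move: (e mu mu) (e mu nu) (e mu rho) (e nu mu) (e nu nu) (e nu rho).
by move: (e rho mu) (e rho nu) (e rho rho) => *; ring.
Qed.

Lemma senergyE (m : sradon R X) : has_energy (spos m) -> has_energy (sneg m) ->
  senergy kappa m m = (denergy (spos m) (sneg m))%:E.
Proof.
move=> pp nn; rewrite /senergy (fenergyK pp pp) (fenergyK nn nn).
by rewrite (fenergyK pp nn) (fenergyK nn pp).
Qed.

(** [mu] and [nu] arise from the Jordan parts by adding the same measure, which [denergy] does not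
    see. *)
Lemma senergy_diff mu nu : has_energy mu -> has_energy nu ->
  senergy kappa (sradon_diff mu nu) (sradon_diff mu nu) = (denergy mu nu)%:E.
Proof.
have [rho [muE nuE]] := sradon_diff_common mu nu.
move=> /(has_energy_eq muE)/has_energy_addl[pp _ _ rr].
move=> /(has_energy_eq nuE)/has_energy_addl[nn _ _ _].
by rewrite senergyE// (eq_denergy muE nuE) denergyDD.
Qed.

(** Two layers of Jordan decomposition are undone: [senergy_diff] removes the outer one, and adding
    [rho] and [rho'] to both sides turns the inner Jordan parts back into the given measures. *)
Lemma senergy_sradon_sub mu nu mu' nu' :
  has_energy mu -> has_energy nu -> has_energy mu' -> has_energy nu' ->
  let m := sradon_sub (sradon_diff mu nu) (sradon_diff mu' nu') in
  senergy kappa m m = (denergy (radon_add mu nu') (radon_add nu mu'))%:E.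
Proof.
have [rho [muE nuE]] := sradon_diff_common mu nu.
have [rho' [mu'E nu'E]] := sradon_diff_common mu' nu'.
move=> /(has_energy_eq muE)/has_energy_addl[pp _ _ rr].
move=> /(has_energy_eq nuE)/has_energy_addl[nn _ _ _].
move=> /(has_energy_eq mu'E)/has_energy_addl[pp' _ _ rr'].
move=> /(has_energy_eq nu'E)/has_energy_addl[nn' _ _ _] m.
rewrite /m /sradon_sub senergy_diff; [|exact: has_energyD|exact: has_energyD].
congr EFin; rewrite -(denergyDD (rho := radon_add rho rho')); last 3 first.
- exact: has_energyD.
- exact: has_energyD.
- exact: has_energyD.
apply/esym/eq_denergy.
  apply: radon_eq_trans (radon_addACA _ _ _ _).
  exact: radon_eq_trans (eq_radon_add muE nu'E) _.
apply: radon_eq_trans (radon_addACA _ _ _ _).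
exact: eq_radon_add.
Qed.

(** A set of positive measure contains a compact [K] of positive measure; [mu] restricted to [K] and
    normalized is a competitor of finite energy in the definition of the capacity, which would then
    be nonzero. *)
Lemma capacity0_negligible mu (Q : set (borel X)) : has_energy mu ->
  measurable Q -> capacity kappa Q = 0 -> mu Q = 0.
Proof.
move=> mm mQ capQ; apply/eqP; rewrite eq_le measure_ge0 andbT.
rewrite (radonP mu).2//; apply: ge_ereal_sup => _ [K [cK KQ] <-].
rewrite leNgt; apply/negP => muK.
have mK := ccompact_measurable cK; have fK := radon_ccompact_fin mu cK.
have fK1 : (0 < fine (mu K))%R by rewrite fine_gt0// muK -ge0_fin_numE.
have fK0 : (0 <= (fine (mu K))^-1)%R by rewrite invr_ge0 fine_ge0.
pose nu := radon_scale (radon_restr mu mK) (NngNum fK0).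
have [mmK _ _ _] := has_energy_addl (has_energy_eq (radon_restrK mu mK) mm).
have nn : has_energy nu by rewrite energyZl// energyZr// fin_numM// fin_numM.
have nuQ : nu Q = 1.
  rewrite /= /mscale /= /mrestr setIC (setIidl KQ) -[mu K](fineK fK).
  by rewrite -EFinM mulVf// gt_eqF.
have nu_carried : carried nu Q.
  move=> L cL; exists (L `\` K); split.
  - by apply: measurableD => //; exact: ccompact_measurable.
  - by rewrite /= /mscale /= /mrestr setDE -setIA setICl setI0 measure0 mule0.
  - by move=> x [Lx Qx]; split=> // Kx; apply: Qx; exact: KQ.
(* Zero capacity says exactly that the infimum of the energies is [+oo]. *)
move: capQ => /eqP; rewrite /capacity inve_eq0 => /eqP infy.
have : +oo <= E nu nu by rewrite -infy; apply: ereal_inf_lbound; exists nu.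
by rewrite leye_eq => /eqP Ey; rewrite Ey in nn.
Qed.

End finite_energy.

(** * Equality of signed differences, and supports *)

Section radon_misc.
Context (R : realType) (X : ptopologicalType).
Implicit Types (mu nu rho : radon R X).

Lemma radon_bigE (I : finType) (P : pred I) (F : I -> radon R X) B :
  (\big[@radon_add R X/radon0]_(i | P i) F i) B = \sum_(i | P i) F i B.
Proof. by apply: (big_morph (fun m : radon R X => m B)) => // m n; exact: radon_addE. Qed.

(** The suprema defining the parts range over bounded Borel sets, where all four measures are finite
    and the hypothesis can be rearranged into equal differences. *)
Lemma sradon_diff_eq mu nu mu' nu' :
  radon_eq (radon_add mu nu') (radon_add nu mu') ->
  sradon_eq (sradon_diff mu nu) (sradon_diff mu' nu').
Proof.
have pos_part_eq m n m' n' : radon_eq (radon_add m n') (radon_add n m') ->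
    radon_eq (radon_pos_part m n) (@radon_pos_part R X m' n').
  move=> mn B mB /=; rewrite /pos_part; congr ereal_sup.
  apply: eq_imagel => C bC; have [mC _ _] := bC.
  have := mn _ mC; rewrite !radon_addE.
  rewrite -(fineK (bounded_fin m bC)) -(fineK (bounded_fin n bC)).
  rewrite -(fineK (bounded_fin m' bC)) -(fineK (bounded_fin n' bC)).
  by rewrite -!(EFinN, EFinD) => -[] ?; congr EFin; lra.
move=> mn; split; apply: pos_part_eq => // B mB.
by have := mn _ mB; rewrite !radon_addE.
Qed.

(** When both parts vanish, [sradon_diffE] equates the two positive measures built from the Jordan
    parts; adding [rho] and [rho'] recovers the given ones. *)
Lemma sradon_sub_is0 mu nu mu' nu' :
  sradon_is0 (sradon_sub (sradon_diff mu nu) (sradon_diff mu' nu')) ->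
  radon_eq (radon_add mu nu') (radon_add nu mu').
Proof.
have [rho [muE nuE]] := sradon_diff_common mu nu.
have [rho' [mu'E nu'E]] := sradon_diff_common mu' nu'.
move=> [pos0 neg0] B mB.
have := sradon_diffE (radon_add (spos (sradon_diff mu nu)) (sneg (sradon_diff mu' nu')))
  (radon_add (sneg (sradon_diff mu nu)) (spos (sradon_diff mu' nu'))) mB.
have E (m1 m2 m3 : radon R X) : radon_add m1 (radon_add m2 m3) B = m1 B + (m2 B + m3 B).
  by rewrite !radon_addE.
rewrite !E (pos0 _ mB) (neg0 _ mB) => D.
rewrite !radon_addE (muE _ mB) (nuE _ mB) (mu'E _ mB) (nu'E _ mB) !radon_addE.
rewrite addeACA [RHS]addeACA; congr (_ + _).
by move: D; rewrite /= /mzero !add0e => ->.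
Qed.

(** The complement of the support may be an uncountable union of null open sets, out of reach of
    countable additivity. A compact subset of [B] is covered by finitely many of them, and inner
    regularity does the rest. *)
Lemma supp_null mu (A : set X) (B : set (borel X)) : supp mu `<=` A ->
  measurable B -> B `<=` ~` A -> mu B = 0.
Proof.
move=> sA mB BA; apply/eqP; rewrite eq_le measure_ge0 andbT.
rewrite (radonP mu).2//; apply: ge_ereal_sup => _ [K [cK KB] <-].
have := cK.1; rewrite compact_cover => /(_ _ [set U | open U /\ mu U = 0] id).
case=> [U []//| |].
  move=> x /KB/BA Ax; apply: contrapT => xN; apply: Ax; apply: sA => U oU Ux.
  rewrite lt0e measure_ge0 andbT; apply/eqP => U0; apply: xN.
  by exists U.
move=> D' D'D KD'.
have mo (U : set X) : open U -> measurable (U : set (borel X)).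
  by move=> oU; exact: sub_sigma_algebra.
have null (s : seq (set X)) : (forall U, U \in s -> open U /\ mu U = 0) ->
    measurable (\big[setU/set0]_(U <- s) U : set (borel X)) /\
    mu (\big[setU/set0]_(U <- s) U) = 0.
  elim: s => [|U s IHs] Hs; first by rewrite big_nil measure0.
  have [|mU' U'0] := IHs; first by move=> V Vs; apply: Hs; rewrite inE Vs orbT.
  have [oU U0] : open U /\ mu U = 0 by apply: Hs; rewrite inE eqxx.
  rewrite big_cons; split; first by apply: measurableU => //; exact: mo.
  by rewrite measureU0//; exact: mo.
have [|mD D0] := null (finmap.enum_fset D').
  by move=> U UD'; have := D'D _ UD'; rewrite inE.
rewrite -D0; apply: le_measure; rewrite ?inE//; first exact: ccompact_measurable.
by apply: subset_trans KD' _; rewrite /cover bigcup_fset.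
Qed.

Lemma supp_radon_add mu nu (A : set X) :
  supp mu `<=` A -> supp nu `<=` A -> closed A -> supp (radon_add mu nu) `<=` A.
Proof.
move=> sm sn cA x sx; apply: contrapT => Ax.
have mA : measurable (~` A : set (borel X)).
  by apply: sub_sigma_algebra; exact: closed_openC.
have := sx (~` A) (closed_openC cA) Ax.
by rewrite radon_addE !(supp_null (A := A))// adde0 ltxx.
Qed.

Lemma supp_radon_scale mu k (A : set X) :
  supp mu `<=` A -> supp (radon_scale mu k) `<=` A.
Proof.
move=> sm x sx; apply: sm => U oU Ux; have := sx _ oU Ux.
rewrite /= /mscale /= !lt0e => /andP[kU _]; rewrite measure_ge0 andbT.
by apply: contraNN kU => /eqP ->; rewrite mule0.
Qed.

Lemma continuous_measurable_EFin (g : X -> R) : continuous g ->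
  measurable_fun [set: borel X] (fun x => (g x)%:E).
Proof.
move=> cg; apply: (@lsc_measurable R X (fun x => (g x)%:E)) => x a.
rewrite lte_fin => agx; exists [set y | (a < g y)%R] => //.
exact: (cvgr_gt (g x) (cg x)).
Qed.

End radon_misc.

(** * Condensers *)

Section condenser_energy.
Context (R : realType) (X : ptopologicalType).
Variable kappa : X * X -> \bar R.
Hypothesis Psi_kappa : Psi kappa.
Hypothesis spd : strictly_positive_definite (R := R) kappa.
Context (I : finType).
Variable s : I -> R.
Hypothesis s_sign : forall i, s i = 1%R \/ s i = (-1)%R.
Implicit Types (mu nu : radon R X) (lam : I -> radon R X).
Local Notation E := (energy kappa).
Local Notation has_energy mu := (E mu mu \is a fin_num).
Local Notation e := (fenergy kappa).
Local Notation plate_sum t lam := (\big[@radon_add R X/radon0]_(i | s i == t) lam i).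

Lemma sum_sign (x : I -> R) : (\sum_i s i * x i =
  \sum_(i | s i == 1) x i - \sum_(i | s i == -1) x i)%R.
Proof.
rewrite [X in (X - _)%R]big_mkcond [X in (_ - X)%R]big_mkcond -sumrB.
apply: eq_bigr => i _; have [->|->] := s_sign i.
  by rewrite eqxx mul1r (_ : 1 == -1 :> R = false)%R ?subr0//; apply/eqP; lra.
by rewrite eqxx mulN1r (_ : -1 == 1 :> R = false)%R ?sub0r//; apply/eqP; lra.
Qed.

Lemma has_energy_sum (P : pred I) lam : (forall i, has_energy (lam i)) ->
  has_energy (\big[@radon_add R X/radon0]_(i | P i) lam i).
Proof.
move=> hl; apply: (big_ind (fun m => has_energy m)) => [|m n hm hn|//].
  by rewrite energy0l.
exact: has_energyD.
Qed.

Lemma fenergy_suml (P : pred I) lam nu :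
  (forall i, has_energy (lam i)) -> has_energy nu ->
  e (\big[@radon_add R X/radon0]_(i | P i) lam i) nu =
  (\sum_(i | P i) e (lam i) nu)%R.
Proof.
(* The induction carries finiteness of the energy along, as additivity of [fenergy] is available
   under that condition. *)
move=> hl hn; suff [] : has_energy (\big[@radon_add R X/radon0]_(i | P i) lam i) /\
    e (\big[@radon_add R X/radon0]_(i | P i) lam i) nu =
    (\sum_(i | P i) e (lam i) nu)%R by [].
apply: (big_ind2 (fun m x => has_energy m /\ e m nu = x))
  => [|m x n y [hm <-] [hn' <-]|i _].
- by split; rewrite /fenergy energy0l.
- by split; [exact: has_energyD|exact: fenergyDl].
- by split.
Qed.

Lemma fenergy_sumr (P : pred I) lam nu :
  (forall i, has_energy (lam i)) -> has_energy nu ->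
  e nu (\big[@radon_add R X/radon0]_(i | P i) lam i) =
  (\sum_(i | P i) e nu (lam i))%R.
Proof.
move=> hl hn; suff [] : has_energy (\big[@radon_add R X/radon0]_(i | P i) lam i) /\
    e nu (\big[@radon_add R X/radon0]_(i | P i) lam i) =
    (\sum_(i | P i) e nu (lam i))%R by [].
apply: (big_ind2 (fun m x => has_energy m /\ e nu m = x))
  => [|m x n y [hm <-] [hn' <-]|i _].
- by split; rewrite /fenergy (energy0l, energy0r).
- by split; [exact: has_energyD|exact: fenergyDr].
- by split.
Qed.

(** The real bilinear form that polarizes [venergy]. *)
Definition cenergy lam lam' : R :=
  (\sum_i \sum_j s i * s j * e (lam i) (lam' j))%R.

Lemma cenergyE lam lam' : (forall i, has_energy (lam i)) ->
  (forall i, has_energy (lam' i)) ->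
  cenergy lam lam' =
  (e (plate_sum 1%R lam) (plate_sum 1%R lam') -
   e (plate_sum 1%R lam) (plate_sum (-1)%R lam') -
   (e (plate_sum (-1)%R lam) (plate_sum 1%R lam') -
    e (plate_sum (-1)%R lam) (plate_sum (-1)%R lam')))%R.
Proof.
move=> hl hl'; rewrite !fenergy_suml//; try exact: has_energy_sum.
rewrite -!sumrB -sum_sign /cenergy; apply: eq_bigr => i _.
rewrite !fenergy_sumr// -sum_sign mulr_sumr.
by apply: eq_bigr => j _; rewrite mulrA.
Qed.

Lemma venergyE lam : (forall i, has_energy (lam i)) ->
  venergy kappa s lam = (cenergy lam lam)%:E.
Proof.
move=> hl; rewrite /venergy /cenergy -sumEFin; apply: eq_bigr => i _.
rewrite -sumEFin; apply: eq_bigr => j _.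
by rewrite EFinM (fenergyK Psi_kappa spd).
Qed.

(** The two arguments have difference [R lam - R lam'], so its squared norm becomes the expansion of
    a quadratic form over the plates. *)
Lemma denergy_plates lam lam' : (forall i, has_energy (lam i)) ->
  (forall i, has_energy (lam' i)) ->
  denergy kappa (radon_add (plate_sum 1%R lam) (plate_sum (-1)%R lam'))
                (radon_add (plate_sum (-1)%R lam) (plate_sum 1%R lam')) =
  (cenergy lam lam + cenergy lam' lam' - (cenergy lam lam' + cenergy lam' lam))%R.
Proof.
move=> hl hl'; rewrite !cenergyE// /denergy.
have := (has_energy_sum (fun i => s i == 1%R) hl,
  has_energy_sum (fun i => s i == (-1)%R) hl,
  has_energy_sum (fun i => s i == 1%R) hl', has_energy_sum (fun i => s i == (-1)%R) hl').
move: (plate_sum 1%R lam) (plate_sum (-1)%R lam)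
  (plate_sum 1%R lam') (plate_sum (-1)%R lam').
move=> P N P' N' [[[hP hN] hP'] hN']; rewrite !(fenergyDD Psi_kappa spd)//.
move: (e P P) (e P N) (e P P') (e P N') (e N P) (e N N) (e N P') (e N N').
move: (e P' P) (e P' N) (e P' P') (e P' N') (e N' P) (e N' N) (e N' P') (e N' N').
by move=> *; ring.
Qed.

Lemma half_ge0 : (0 <= 2^-1 :> R)%R.
Proof. by rewrite invr_ge0. Qed.

Definition midpoint lam lam' i : radon R X :=
  radon_scale (radon_add (lam i) (lam' i)) (NngNum half_ge0).

Lemma has_energy_midpoint lam lam' i : (forall i, has_energy (lam i)) ->
  (forall i, has_energy (lam' i)) -> has_energy (midpoint lam lam' i).
Proof.
move=> hl hl'; rewrite /midpoint energyZl// energyZr// fin_numM// fin_numM//.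
exact: has_energyD.
Qed.

Lemma cenergy_midpoint lam lam' : (forall i, has_energy (lam i)) ->
  (forall i, has_energy (lam' i)) ->
  cenergy (midpoint lam lam') (midpoint lam lam') =
  ((cenergy lam lam + cenergy lam' lam' + cenergy lam lam' + cenergy lam' lam) / 4)%R.
Proof.
move=> hl hl'; rewrite /cenergy -!big_split /= mulr_suml; apply: eq_bigr => i _.
rewrite -!big_split /= mulr_suml; apply: eq_bigr => j _.
have eM mu nu : has_energy mu -> has_energy nu -> e (radon_scale mu (NngNum half_ge0))
    (radon_scale nu (NngNum half_ge0)) = (2^-1 * (2^-1 * e mu nu))%R.
  move=> hm hn; rewrite /fenergy energyZl// energyZr//.
  by rewrite (fenergyK Psi_kappa spd hm hn).
rewrite eM; [|exact: has_energyD|exact: has_energyD].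
rewrite (fenergyDD Psi_kappa spd (hl i) (hl' i) (hl j) (hl' j)).
move: (e (lam i) (lam j)) (e (lam i) (lam' j)) (e (lam' i) (lam j)) (e (lam' i) (lam' j)).
by move=> *; field.
Qed.

End condenser_energy.

(** * Midpoints of minimizers and uniqueness *)

Section minimizers.
Context (R : realType) (X : ptopologicalType).
Variable kappa : X * X -> \bar R.
Hypothesis Psi_kappa : Psi kappa.
Hypothesis spd : strictly_positive_definite (R := R) kappa.
Context (I : finType).
Variables (A : I -> set X) (s : I -> R) (f : I -> X -> \bar R).
Variables (a : I -> R) (g : I -> X -> R) (sigma : I -> radon R X).
Hypothesis closedA : forall i, closed (A i).
Hypothesis s_sign : forall i, s i = 1%R \/ s i = (-1)%R.
Hypothesis mf : forall i, measurable_fun [set: borel X] (f i).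
Hypothesis g_cont : forall i, continuous (g i).
Implicit Types (mu nu : radon R X) (lam : I -> radon R X).
Local Notation E := (energy kappa).
Local Notation has_energy mu := (E mu mu \is a fin_num).
Local Notation cen := (cenergy kappa s).

Definition field_integral lam : R := (\sum_i fine (\int[lam i]_x f i x))%R.

Lemma finite_energy_has_energy lam : condenser_finite_energy kappa A lam ->
  forall i, has_energy (lam i).
Proof.
move=> [_ El] i; rewrite fin_numElt; apply/andP; split; last exact: El.
exact: energy_gtNy.
Qed.

(** An extended sum is finite only if all its terms are; as the energy part is a real number,
    finiteness passes to each field integral. *)
Lemma gauss_fin_num lam : (forall i, has_energy (lam i)) ->
  gauss kappa s f lam \is a fin_num ->
  forall i, \int[lam i]_x f i x \is a fin_num.
Proof.
move=> hl; rewrite /gauss venergyE//.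
have fin2 (r : R) (x : \bar R) : r%:E + 2%:E * x \is a fin_num -> x \is a fin_num.
  case: x => // ; first by rewrite gt0_muley.
  by rewrite gt0_muleNy.
move=> /fin2/sum_fin_numP fI i.
by apply: fI => //; rewrite mem_index_enum.
Qed.

Lemma gaussE lam : (forall i, has_energy (lam i)) ->
  (forall i, \int[lam i]_x f i x \is a fin_num) ->
  gauss kappa s f lam = (cen lam lam + 2 * field_integral lam)%:E.
Proof.
move=> hl fI; rewrite /gauss venergyE//.
have -> : \sum_i \int[lam i]_x f i x = (field_integral lam)%:E.
  by rewrite /field_integral -sumEFin; apply: eq_bigr => i _; rewrite fineK.
by rewrite -EFinM -EFinD.
Qed.

Lemma integral_midpoint (h : X -> \bar R) lam lam' i :
  measurable_fun [set: borel X] h ->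
  \int[lam i]_x h x \is a fin_num -> \int[lam' i]_x h x \is a fin_num ->
  \int[midpoint lam lam' i]_x h x =
  (2^-1 * (fine (\int[lam i]_x h x) + fine (\int[lam' i]_x h x)))%:E.
Proof.
move=> mh hl hl'.
have gtNy (x : \bar R) : x \is a fin_num -> -oo < x by rewrite fin_numElt => /andP[].
have addE := integral_radon_addE mh (gtNy _ hl) (gtNy _ hl').
rewrite /midpoint integral_radon_scaleE//; last first.
  by rewrite addE -(fineK hl) -(fineK hl') -EFinD ltNyr.
by rewrite addE -{1}(fineK hl) -{1}(fineK hl') -EFinD -EFinM.
Qed.

Lemma admissible_midpoint lam lam' :
  admissible kappa A s f a g sigma lam -> admissible kappa A s f a g sigma lam' ->
  admissible kappa A s f a g sigma (midpoint lam lam').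
Proof.
move=> [Cl Gl sl gl] [Cl' Gl' sl' gl'].
have hl := finite_energy_has_energy Cl; have hl' := finite_energy_has_energy Cl'.
have hm i : has_energy (midpoint lam lam' i) by exact: has_energy_midpoint.
have fl := gauss_fin_num hl Gl; have fl' := gauss_fin_num hl' Gl'.
split.
- split=> i; last first.
    by have := hm i; rewrite fin_numElt => /andP[].
  apply: supp_radon_scale; apply: supp_radon_add => //; [exact: Cl.1|exact: Cl'.1].
- rewrite gaussE// => i; by rewrite integral_midpoint.
- move=> i B mB; rewrite /= /mscale radon_addE /=.
  have half_le (x y z : \bar R) : 0 <= x -> 0 <= y -> x <= z -> y <= z ->
      (2^-1)%:E * (x + y) <= z.
    case: x y z => [x||] [y||] [z||] //; rewrite ?leey// !lee_fin.
    by lra.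
  exact: half_le (sl _ _ mB) (sl' _ _ mB).
- move=> i; rewrite (@integral_midpoint (fun x => (g i x)%:E)) ?gl ?gl'//=.
    by congr EFin; lra.
  exact: continuous_measurable_EFin.
Qed.

Lemma field_integral_midpoint lam lam' :
  (forall i, \int[lam i]_x f i x \is a fin_num) ->
  (forall i, \int[lam' i]_x f i x \is a fin_num) ->
  field_integral (midpoint lam lam') =
  (2^-1 * (field_integral lam + field_integral lam'))%R.
Proof.
move=> fl fl'; rewrite /field_integral -big_split mulr_sumr.
by apply: eq_bigr => i _; rewrite integral_midpoint.
Qed.

(** With [q] the quadratic part, [q(mid) = (q(lam) + q(lam')) / 2 - q(lam - lam') / 4], while the
    field term is affine. Averaging the two inequalities between the minimum and the value at the
    midpoint leaves [q(lam - lam') <= 0]. *)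
Lemma cenergy_solutions_le lam lam' :
  solution kappa A s f a g sigma lam -> solution kappa A s f a g sigma lam' ->
  (cen lam lam + cen lam' lam' - (cen lam lam' + cen lam' lam) <= 0)%R.
Proof.
move=> [Al Ginf] [Al' Ginf'].
have Am := admissible_midpoint Al Al'.
have [[Cl Gl _ _] [Cl' Gl' _ _] [Cm Gm _ _]] := And3 Al Al' Am.
have hl := finite_energy_has_energy Cl; have hl' := finite_energy_has_energy Cl'.
have hm := finite_energy_has_energy Cm.
have fl := gauss_fin_num hl Gl; have fl' := gauss_fin_num hl' Gl'.
have fm := gauss_fin_num hm Gm.
have le_m : gauss_inf kappa A s f a g sigma <= gauss kappa s f (midpoint lam lam').
  by apply: ereal_inf_lbound; exists (midpoint lam lam').
have := le_m; rewrite -{1}Ginf !gaussE// lee_fin.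
have := le_m; rewrite -{1}Ginf' !gaussE// lee_fin.
rewrite field_integral_midpoint// cenergy_midpoint//.
move: (field_integral lam) (field_integral lam').
move: (cen lam lam) (cen lam lam') (cen lam' lam) (cen lam' lam') => *.
by lra.
Qed.

Lemma senergy_solutions lam lam' :
  solution kappa A s f a g sigma lam -> solution kappa A s f a g sigma lam' ->
  let m := sradon_sub (Rmap s lam) (Rmap s lam') in
  senergy kappa m m = 0 /\ sradon_is0 m.
Proof.
move=> Sl Sl' m; have le0 := cenergy_solutions_le Sl Sl'.
have [[Cl _ _ _] _] := Sl; have [[Cl' _ _ _] _] := Sl'.
have hl := finite_energy_has_energy Cl; have hl' := finite_energy_has_energy Cl'.
have mE : senergy kappa m m =
    (cen lam lam + cen lam' lam' - (cen lam lam' + cen lam' lam))%:E.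
  rewrite /m senergy_sradon_sub// ?denergy_plates//; exact: has_energy_sum.
have [] := spd (m := m); last first.
  rewrite mE lee_fin => ge0 is0.
  have E0 : (cen lam lam + cen lam' lam' - (cen lam lam' + cen lam' lam) = 0)%R.
    by apply/eqP; rewrite eq_le le0.
  by rewrite E0; split=> //; apply: is0; rewrite E0.
(* By [mE] the total energy is a finite number, so its subtracted term is finite, as the second
   alternative of [senergy_defined] asks. *)
have fin_diff (x y : \bar R) : x - y \is a fin_num -> y \is a fin_num.
  by case: x y => [x||] [y||].
right; apply: (@fin_diff (E (spos m) (spos m) + E (sneg m) (sneg m))).
by rewrite -/(senergy kappa m m) mE.
Qed.

Lemma Rmap_solutions lam lam' :
  solution kappa A s f a g sigma lam -> solution kappa A s f a g sigma lam' ->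
  radon_eq
    (radon_add (\big[@radon_add R X/radon0]_(i | s i == 1%R) lam i)
               (\big[@radon_add R X/radon0]_(i | s i == (-1)%R) lam' i))
    (radon_add (\big[@radon_add R X/radon0]_(i | s i == (-1)%R) lam i)
               (\big[@radon_add R X/radon0]_(i | s i == 1%R) lam' i)).
Proof.
by move=> Sl Sl'; apply: sradon_sub_is0; exact: (senergy_solutions Sl Sl').2.
Qed.

Lemma essentially_disjoint_unique lam lam' :
  (forall i j, i != j -> capacity kappa (A i `&` A j) = 0) ->
  solution kappa A s f a g sigma lam -> solution kappa A s f a g sigma lam' ->
  forall i, radon_eq (lam i) (lam' i).
Proof.
move=> capA Sl Sl' i B mB; have Req := Rmap_solutions Sl Sl'.
have mA j : measurable (A j : set (borel X)).
  rewrite -[A j]setCK; apply: measurableC.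
  by apply: sub_sigma_algebra; exact: closed_openC.
(* [W] is the part of [A i] shared with the other plates; on [A i] minus [W] only the component [i]
   can have mass. *)
pose W := \big[setU/set0]_(j | j != i) (A i `&` A j : set (borel X)).
have mW : measurable W by apply: bigsetU_measurable => j _; exact: measurableI.
have mAW : measurable ((A i : set (borel X)) `\` W) by exact: measurableD.
pose C := B `&` (A i `\` W); have mC : measurable C by exact: measurableI.
have C_j l j : solution kappa A s f a g sigma l -> j != i -> l j C = 0.
  move=> [[[cl _] _ _ _] _] ji; apply: supp_null (cl j) mC _ => x [_ [Aix Wx]] Ajx.
  by apply: Wx; rewrite /W -bigcup_seq_cond; exists j => //=; rewrite mem_index_enum.
(* [C] carries all the mass of [l i] in [B]: the complement of [A i] is off the support, and [W] is
   a finite union of sets of zero capacity. *)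
have C_i l : solution kappa A s f a g sigma l -> l i C = l i B.
  move=> [[Cl _ _ _] _]; have hl := finite_energy_has_energy Cl.
  have [_ W0] : measurable W /\ l i W = 0.
    apply: (big_ind (fun S => measurable S /\ l i S = 0)).
    - by split.
    - move=> S T [mS S0] [mT T0]; split; first exact: measurableU.
      by rewrite measureU0.
    - move=> j ji; have mij : measurable (A i `&` A j : set (borel X)).
        exact: measurableI.
      split=> //; apply: (capacity0_negligible Psi_kappa (hl i) mij).
      by apply: capA; rewrite eq_sym.
  rewrite [RHS](radon_restrK _ mAW mB) radon_addE /= /mrestr -[LHS]adde0.
  congr (_ + _); apply/esym/eqP; rewrite eq_le measure_ge0 andbT.
  have mcA : measurable (~` A i : set (borel X)) by exact: measurableC.
  rewrite -(supp_null (Cl.1 i) mcA (@subset_refl _ _)) -(measureU0 mcA mW W0).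
  apply: le_measure; rewrite ?inE; [|exact: measurableU|].
    by apply: measurableI => //; exact: measurableC.
  move=> x [_ ADx]; have [Ax|] := pselect (A i x); last by left.
  by right; apply: contrapT => Wx; apply: ADx.
(* On [C] each plate sum in [Rmap_solutions] keeps at most the component [i], and keeps it for the
   sign of [A i] only. *)
have sumE l t : solution kappa A s f a g sigma l ->
    (\big[@radon_add R X/radon0]_(j | s j == t) l j) C =
    if s i == t then l i B else 0.
  move=> Sol; rewrite radon_bigE; case: ifPn => [st|st].
    rewrite (bigD1 i)//= C_i// big1 ?adde0// => j /andP[_ ji].
    exact: C_j.
  rewrite big1// => j sj; apply: C_j => //.
  by apply: contraNneq st => <-.
have := Req _ mC; rewrite !radon_addE !sumE//.
have ne1 : (1 == -1 :> R)%R = false by apply/eqP; lra.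
have ne1' : (-1 == 1 :> R)%R = false by apply/eqP; lra.
by case: (s_sign i) => ->; rewrite eqxx ?ne1 ?ne1' !(adde0, add0e).
Qed.

End minimizers.

Unset Implicit Arguments.

Theorem lemma5p4 (R : realType) (X : ptopologicalType)
  (hausX : hausdorff_space X) (lcX : locally_compact [set: X])
  (kappa : X * X -> \bar R) (ker_kappa : is_kernel kappa)
  (spd_kappa : strictly_positive_definite kappa)
  (I : finType) (A : I -> set X) (s : I -> R)
  (cond_A : is_condenser kappa A s)
  (cap_A : forall i, 0 < capacity kappa (A i))
  (f : I -> X -> \bar R) (field_f : external_field kappa s f)
  (a : I -> R) (a_gt0 : forall i, (0 < a i)%R)
  (g : I -> X -> R) (g_cont : forall i, continuous (g i))
  (g_gt0 : forall i x, (0 < g i x)%R)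
  (g_inf : forall i, (0 < inf (range (g i)))%R)
  (sigma : I -> radon R X) (constr_sigma : is_constraint A a g sigma)
  (finite_inf : gauss_inf kappa A s f a g sigma < +oo) :
  (forall lam lam' : I -> radon R X,
     solution kappa A s f a g sigma lam ->
     solution kappa A s f a g sigma lam' ->
     condenser_dist kappa s lam lam' = 0 /\
     sradon_eq (Rmap s lam) (Rmap s lam')) /\
  ((forall i j, i != j -> capacity kappa (A i `&` A j) = 0) ->
   forall lam lam' : I -> radon R X,
     solution kappa A s f a g sigma lam ->
     solution kappa A s f a g sigma lam' ->
     forall i, radon_eq (lam i) (lam' i)).
Proof.
have [Psi_kappa _] := ker_kappa; have [cA s_sign _] := cond_A.
have closedA i : closed (A i) by have [] := cA i.
(* In the first case the field is lower semicontinuous; in the second it is a multiple of a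
   difference of potentials, each measurable by [tame_pot]. *)
have mf i : measurable_fun [set: borel X] (f i).
  case: field_f => [Pf|[zeta _ fE]]; first exact: (Psi_tame (Pf i)).1.
  rewrite (_ : f i = fun x => (s i)%:E * spot kappa zeta x); last first.
    by apply/funext => x; exact: fE.
  apply: measurable_funeM; apply: emeasurable_funB.
    exact: (tame_pot Psi_kappa (spos zeta)).1.
  exact: (tame_pot Psi_kappa (sneg zeta)).1.
split=> [lam lam' Sl Sl'|capA lam lam' Sl Sl' i]; last first.
  exact: (essentially_disjoint_unique Psi_kappa spd_kappa closedA s_sign mf
    g_cont capA Sl Sl').
split; last first.
  apply: sradon_diff_eq.
  exact: (Rmap_solutions Psi_kappa spd_kappa closedA s_sign mf g_cont Sl Sl').
have [E0 _] :=
  senergy_solutions Psi_kappa spd_kappa closedA s_sign mf g_cont Sl Sl'.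
by rewrite /condenser_dist /knorm E0 sqrte0.
Qed.
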